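(* Let $Q_t$ be the number in system of an infinite server queue with finite, time-varying arrival rate $\lambda(t)>0$, exponential service rate $\mu>0$, and random batch size with finite mean $\mathbb{E}[N]$. Then the mean number in system is $$\mathbb{E}[Q_t]=Q_0e^{-\mu t}+e^{-\mu t}\,\mathbb{E}[N]\int_0^t\lambda(s)e^{\mu s}\,\mathrm{d}s$$ for all $t\ge0$. If moreover the batch size distribution has finite second moment $\mathbb{E}[N^2]$, the variance of the number in system is $$\mathrm{Var}(Q_t)=Q_0(e^{-\mu t}-e^{-2\mu t})+e^{-2\mu t}\left(\mathbb{E}[N^2]-\mathbb{E}[N]\right)\int_0^t\lambda(s)e^{2\mu s}\,\mathrm{d}s+e^{-\mu t}\,\mathbb{E}[N]\int_0^t\lambda(s)e^{\mu s}\,\mathrm{d}s$$ for all $t\ge0$.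
   Context: Model: batches arrive at the epochs of a non-homogeneous Poisson process with (locally integrable) intensity $\lambda(t)$. Batch sizes are i.i.d. copies of a non-negative integer valued random variable $N$. There are infinitely many servers, so each customer starts service immediately and leaves after an independent $\mathrm{Exp}(\mu)$ service time; arrival epochs, batch sizes and services are mutually independent. $Q_t$ is the number of customers present at time $t$; $Q_0$, the initial number, is a deterministic non-negative integer (initial customers also have independent $\mathrm{Exp}(\mu)$ remaining services). *)

(* Defs.v *)
From HB Require Import structures.
From mathcomp Require Import all_boot all_order all_algebra finmap.
From mathcomp Require Import all_classical all_reals all_analysis.

Set Implicit Arguments.
Unset Strict Implicit.
Unset Printing Implicit Defensive.

Import Order.TTheory GRing.Theory Num.Theory.
Import numFieldNormedType.Exports.

Local Open Scope classical_set_scope.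
Local Open Scope ring_scope.

(* sigma(X) *)
Definition sigma_of (aT : Type) d' (rT : measurableType d') (X : aT -> rT) :
    set_system aT :=
  preimage_set_system [set: aT] X measurable.

Definition mutually_independent d (T : measurableType d) (R : realType)
    (P : probability T R) (I : choiceType) (F : I -> set_system T) : Prop :=
  forall (J : {fset I}) (E : I -> set T),
    (forall i, i \in J -> F i (E i)) ->
    P (\bigcap_(i in [set` J]) E i) = (\prod_(i <- J) P (E i))%E.

(* Counting process on the time set [0, +oo[ (its values at negative times are
   irrelevant). The natural-number subtractions below are genuine by
   monotonicity, and the last argument of [poisson_prob] is a dummy. *)
Record poisson_process d (T : measurableType d) (R : realType)
    (P : probability T R) (lambda : R -> R) (M : R -> {RV P >-> nat}) : Prop := {
  poisson_start : forall w, M 0 w = 0%N ;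
  poisson_mono : forall w (s t : R), 0 <= s -> s <= t -> (M s w <= M t w)%N ;
  poisson_rcont : forall w (t : R), 0 <= t -> \forall s \near t^'+, M s w = M t w ;
  poisson_indep_increments : forall t : nat -> R,
    0 <= t 0%N -> nondecreasing_seq t ->
    mutually_independent P
      (fun i => sigma_of (fun w => (M (t i.+1) w - M (t i) w)%N)) ;
  poisson_increments : forall s t : R, 0 <= s -> s <= t -> forall B : set nat,
    P [set w | B (M t w - M s w)%N] =
    poisson_prob (\int[lebesgue_measure]_(u in `[s, t]) lambda u) 0%N B
}.

(* Time of the event number k (counted from 0) of the counting process M;
   meaningful on the paths where M eventually exceeds k. *)
Definition epoch (T : Type) (R : realType) (M : R -> T -> nat) (k : nat)
    (w : T) : R :=
  inf [set s | 0 <= s /\ (k < M s w)%N].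

(* The independent sources of randomness: the arrival process, the size of the
   k-th batch, the service time of the j-th customer of the k-th batch, and the
   remaining service time of the j-th initial customer. *)
Inductive source (q0 : nat) : Type :=
  | Arrivals
  | Batch of nat
  | Service of nat & nat
  | Initial of 'I_q0.

HB.instance Definition _ (q0 : nat) := gen_eqMixin (source q0).
HB.instance Definition _ (q0 : nat) := gen_choiceMixin (source q0).

Definition source_sigma d (T : measurableType d) (R : realType)
    (P : probability T R) (q0 : nat) (M : R -> {RV P >-> nat})
    (B : nat -> {RV P >-> nat}) (S : nat -> nat -> {RV P >-> R})
    (S0 : 'I_q0 -> {RV P >-> R}) (x : source q0) : set_system T :=
  match x with
  | Arrivals => <<s \bigcup_(t in `[0, +oo[) sigma_of (M t) >>
  | Batch k => sigma_of (B k)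
  | Service k j => sigma_of (S k j)
  | Initial j => sigma_of (S0 j)
  end.

(* [batch k] is the number of customers arriving at [epoch arrivals k];
   [service k j] is only used when j < batch k. *)
Record infinite_server_queue d (T : measurableType d) (R : realType)
    (P : probability T R) (lambda : R -> R) (mu : R) (N : {RV P >-> nat})
    (q0 : nat) := {
  arrivals : R -> {RV P >-> nat} ;
  batch : nat -> {RV P >-> nat} ;
  service : nat -> nat -> {RV P >-> R} ;
  initial : 'I_q0 -> {RV P >-> R} ;
  arrivalsP : poisson_process lambda arrivals ;
  batchP : forall k (A : set nat),
    distribution P (batch k) A = distribution P N A ;
  serviceP : forall k j (A : set R), measurable A ->
    distribution P (service k j) A = exponential_prob mu A ;
  initialP : forall j (A : set R), measurable A ->
    distribution P (initial j) A = exponential_prob mu A ;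
  sourcesP :
    mutually_independent P (source_sigma arrivals batch service initial)
}.

(* Q_t: the initial customers, and the customers of the batches arrived by time
   t, that have not left at time t; each boolean counts as 0 or 1. *)
Definition number_in_system d (T : measurableType d) (R : realType)
    (P : probability T R) (lambda : R -> R) (mu : R) (N : {RV P >-> nat})
    (q0 : nat) (Q : infinite_server_queue lambda mu N q0) (t : R) (w : T) : nat :=
  (\sum_(j < q0) (t < initial Q j w)%R +
   \sum_(k < arrivals Q t w) \sum_(j < batch Q k w)
      (t < epoch (arrivals Q) k w + service Q k j w)%R)%N.

(* Main.v *)
Require Import Defs.
From mathcomp Require Import all_boot all_order all_algebra.
From mathcomp Require Import all_classical all_reals all_analysis.
From mathcomp Require Import finmap ring lra zify measurable_realfun.

(** Why the formulas hold. Given the arrival epochs tau_k before t and the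
    batch sizes, each customer of batch k is still present independently with
    probability p(tau_k) = exp(- mu (t - tau_k)). Hence, given the epochs,
    batch k contributes E[N] p(tau_k) on average, and its contribution X_k has
    E[X_k^2] = E[N] p(tau_k) + (E[N^2] - E[N]) p(tau_k)^2, the two terms coming
    from one customer and from ordered pairs of distinct customers. Summing
    over a Poisson process of intensity lambda turns a sum over epochs into an
    integral against lambda, and distinct epochs contribute the square of the
    mean, which the variance removes. The initial customers are independent
    Bernoulli variables with parameter exp(- mu t).

    Conditioning on the random epochs is avoided by a double approximation.
    The interval [0, t] is cut into n + 1 cells and every epoch is moved back
    to the left end of its cell; moreover only the first K batches, and the
    first K customers of each, are kept. What remains is a finite sum of
    indicators of intersections of events of independent sources: the k-th
    arrival falls in cell i, batch k has a member number j, a service time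
    exceeds a constant. Its first two moments are therefore finite algebra
    ([truncated_count_mean], [truncated_count_second_moment]).

    Both approximations are bounded by their limit and are eventually equal to
    it on each path, the counts being integer valued. So Fatou's
    lemma and domination make the moments converge, possibly to infinity
    ([cvg_integral_stationary]). As K tends to infinity the truncated
    moments become E[N], E[N^2] and the moments of independent Poisson
    increments ([increment_mean], [increment_mean_mul]). As n tends to
    infinity the sums over cells become integrals: since p is exponential, its
    oscillation on a cell is a constant factor that tends to 1
    ([cvg_riemann_sum]). *)

Import Order.TTheory GRing.Theory Num.Theory.
Import numFieldNormedType.Exports.

Local Open Scope classical_set_scope.
Local Open Scope ring_scope.

Set Implicit Arguments.
Unset Strict Implicit.
Unset Printing Implicit Defensive.

(** * Integrals of indicator sums *)

(** Fatou's lemma bounds the limit inferior of the integrals from below by the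
    integral of the limit, and domination bounds every integral from above by
    it. The limit may be infinite, so that one statement yields both the values
    of the moments and their finiteness. *)
Lemma cvg_integral_stationary d (T : measurableType d) (R : realType)
    (P : {measure set T -> \bar R}) (f_ : nat -> T -> R) (f : T -> R) :
  (forall n, measurable_fun setT (f_ n)) ->
  (forall n w, 0 <= f_ n w <= f w) ->
  (forall w, \forall n \near \oo, f_ n w = f w) ->
  measurable_fun setT f /\
  (\int[P]_w (f_ n w)%:E)%E @[n --> \oo] --> (\int[P]_w (f w)%:E)%E.
Proof.
move=> mf f0 ff.
have cvgf w : f_ n w @[n --> \oo] --> f w.
  by apply: cvg_near_cst; apply: ff.
have mf' : measurable_fun setT f.
  by apply: (@measurable_fun_cvg _ _ _ _ f_) => // w _; exact: cvgf.
split => //.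
have ub n : (\int[P]_w (f_ n w)%:E <= \int[P]_w (f w)%:E)%E.
  apply: ge0_le_integral => //.
  - by move=> w _; rewrite lee_fin; case/andP: (f0 n w).
  - exact/measurable_EFinP.
  - exact/measurable_EFinP.
  - by move=> w _; rewrite lee_fin; case/andP: (f0 n w).
have lb : (\int[P]_w (f w)%:E <= limn_einf (fun n => \int[P]_w (f_ n w)%:E))%E.
  have -> : (\int[P]_w (f w)%:E = \int[P]_w limn_einf (fun n => (f_ n w)%:E))%E.
    apply: eq_integral => w _; symmetry.
    have cvgE : (f_ n w)%:E @[n --> \oo] --> (f w)%:E.
      exact/(cvg_comp _ _ (cvgf w)).
    by rewrite is_cvg_limn_einfE; [apply: cvg_lim|apply: cvgP; exact: cvgE].
  apply: fatou => //.
    by move=> n; apply/measurable_EFinP.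
  by move=> n w _; rewrite lee_fin; case/andP: (f0 n w).
suff : (- \int[P]_w (f_ n w)%:E)%E @[n --> \oo] --> (- \int[P]_w (f w)%:E)%E.
  by move=> /cvgeN; rewrite oppeK; under eq_fun do rewrite oppeK.
apply: limn_esup_le_cvg; last by move=> n; rewrite leeN2.
have := limn_esupN (fun n => \int[P]_w (f_ n w)%:E)%E.
by rewrite /comp => ->; rewrite leeN2.
Qed.

Lemma cvg_EFin_seq (R : realType) (u : nat -> R) (l : R) :
  u n @[n --> \oo] --> l -> (u n)%:E @[n --> \oo] --> l%:E.
Proof. by move=> ul; exact/(cvg_comp _ _ ul). Qed.

Section indicator_sums.
Context d (T : measurableType d) (R : realType) (P : probability T R).

Lemma integral_sum_indic (I : finType) (c : I -> R) (E : I -> set T) :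
  (forall i, 0 <= c i) -> (forall i, measurable (E i)) ->
  (\int[P]_w (\sum_i c i * \1_(E i) w)%:E = (\sum_i c i * fine (P (E i)))%:E)%E.
Proof.
move=> c0 mE; under eq_integral do rewrite -sumEFin.
rewrite ge0_integral_sum//; first last.
- by move=> i w _; rewrite lee_fin mulr_ge0.
- move=> i; apply/measurable_EFinP; apply: measurable_funM => //.
rewrite -sumEFin; apply: eq_bigr => i _.
under eq_integral do rewrite EFinM.
rewrite ge0_integralZl//; first last.
- by rewrite lee_fin.
- exact/measurable_EFinP/measurable_indic.
by rewrite integral_indic// setIT EFinM fineK// fin_num_measure.
Qed.

Lemma integral_sum_indic_unit (I : finType) (E : I -> set T) :
  (forall i, measurable (E i)) ->
  (\int[P]_w (\sum_i \1_(E i) w)%:E = (\sum_i fine (P (E i)))%:E)%E.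
Proof.
move=> mE; have := @integral_sum_indic I (fun=> 1) E (fun=> ler01) mE.
under eq_integral do under eq_bigr do rewrite mul1r.
by move=> ->; under eq_bigr do rewrite mul1r.
Qed.

Lemma mul_sum_indic (I J : finType) (E : I -> set T) (F : J -> set T) w :
  (\sum_i \1_(E i) w) * (\sum_j \1_(F j) w) =
  \sum_(x : I * J) \1_(E x.1 `&` F x.2) w :> R.
Proof.
rewrite -(pair_bigA _ (fun i j => \1_(E i `&` F j) w)) /= mulr_suml.
apply: eq_bigr => i _; rewrite mulr_sumr; apply: eq_bigr => j _.
by rewrite indicI.
Qed.

Lemma integral_mul_sum_indic (I J : finType) (E : I -> set T) (F : J -> set T) :
  (forall i, measurable (E i)) -> (forall j, measurable (F j)) ->
  (\int[P]_w ((\sum_i \1_(E i) w) * (\sum_j \1_(F j) w))%:E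
     = (\sum_i \sum_j fine (P (E i `&` F j)))%:E)%E.
Proof.
move=> mE mF; under eq_integral do rewrite mul_sum_indic.
rewrite integral_sum_indic_unit; last by move=> x; apply: measurableI.
by rewrite -(pair_bigA _ (fun i j => fine (P (E i `&` F j)))).
Qed.

Lemma indic_bool (b : T -> bool) w : \1_[set w | b w] w = (b w)%:R :> R.
Proof.
rewrite indicE; congr (nat_of_bool _)%:R.
by apply/idP/idP => [/set_mem|bw]; last exact/mem_set.
Qed.

(** Independence for an explicit list of pairwise distinct sources: this form
    is convenient when the sources are syntactically given. *)
Lemma mutually_independent_seq (I : choiceType) (F : I -> set_system T)
    (xs : seq I) (Es : seq (set T)) x0 :
  mutually_independent P F -> uniq xs -> size xs = size Es ->
  (forall n, (n < size xs)%N -> F (nth x0 xs n) (nth setT Es n)) ->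
  (forall n, measurable (nth setT Es n)) ->
  fine (P (\big[setI/setT]_(E <- Es) E)) = \prod_(E <- Es) fine (P E).
Proof.
move=> indep uxs sxs FE mEs.
(* The independence hypothesis speaks of events indexed by the sources. *)
pose E x := nth setT Es (index x xs).
have EE : Es = map E xs.
  apply: (@eq_from_nth _ setT); rewrite ?size_map// => i iE.
  by rewrite (nth_map x0) ?sxs// /E index_uniq ?sxs.
have := indep [fset x in xs]%fset E.
have xsP : perm_eq [fset x in xs]%fset xs.
  apply: uniq_perm => // x; by rewrite !inE.
move=> H; rewrite EE !big_map.
have -> : \big[setI/setT]_(i <- xs) E i = \bigcap_(i in [set` [fset x in xs]%fset]) E i.
  rewrite bigcap_fset; apply: perm_big; by rewrite perm_sym.
rewrite H; last first.
  move=> i; rewrite !inE => ixs; rewrite /E -{1}(nth_index x0 ixs).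
  by apply: FE; rewrite index_mem.
rewrite (perm_big _ xsP) /=.
have mE x : measurable (E x) by exact: mEs.
have -> : (\prod_(i <- xs) P (E i) = (\prod_(i <- xs) fine (P (E i)))%:E)%E.
  rewrite (big_morph EFin (@EFinM R) (erefl _)); apply: eq_bigr => x _.
  by rewrite fineK// fin_num_measure.
by [].
Qed.

End indicator_sums.

(** * Counting variables and Poisson moments *)

(** Summing the indicators of these events over k counts b - a. With a = 0 they
    are the tail events k < b; with a and b the values of a counting process at
    the ends of a cell, they say that event number k falls in the cell. *)
Definition between (T : Type) (a b : T -> nat) (k : nat) : set T :=
  [set w | (a w <= k < b w)%N].

Lemma sum_between (a b K : nat) :
  (\sum_(k < K) (a <= k < b) = minn K b - a)%N.
Proof.
elim: K => [|K IH]; first by rewrite big_ord0 min0n.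
by rewrite big_ord_recr /= IH; case: (leqP a K); case: (ltnP K b) => /=; lia.
Qed.

Section counts.
Context d (T : measurableType d) (R : realType) (P : probability T R).
Implicit Types a b : T -> nat.

Lemma sum_indic_between a b K w :
  \sum_(k < K) \1_(between a b k) w = (minn K (b w) - a w)%N%:R :> R.
Proof.
rewrite -sum_between natr_sum; apply: eq_bigr => k _.
by rewrite /between (@indic_bool _ _ _ (fun w => a w <= k < b w)%N).
Qed.

(** The tail-sum formula E[X] = sum_k P(k < X), for X = b - a. *)
Lemma cvg_sum_between a b : (forall k, measurable (between a b k)) ->
  (\sum_(k < K) fine (P (between a b k)))%:E @[K --> \oo] -->
    (\int[P]_w ((b w - a w)%N%:R)%:E)%E.
Proof.
move=> mE.
have := @cvg_integral_stationary _ _ _ P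
  (fun K w => \sum_(k < K) \1_(between a b k) w) (fun w => (b w - a w)%N%:R).
case.
- by move=> K; apply: measurable_sum => i; exact: measurable_indic.
- move=> K w; rewrite sum_indic_between ler0n/= ler_nat; lia.
- move=> w; near=> K; rewrite sum_indic_between.
  have : (b w <= K)%N by near: K; exact: nbhs_infty_ge.
  by move=> /minn_idPr ->.
move=> _ cf; apply: cvg_trans cf; apply: near_eq_cvg; apply: nearW => K.
by rewrite integral_sum_indic_unit.
Unshelve. all: by end_near. Qed.

(** The tail-sum formula for products, which reduces mixed second moments to
    probabilities of intersections of two events. *)
Lemma cvg_sum_between2 a b a' b' :
  (forall k, measurable (between a b k)) ->
  (forall k, measurable (between a' b' k)) ->
  (\sum_(k < K) \sum_(l < K) fine (P (between a b k `&` between a' b' l)))%:E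
    @[K --> \oo] -->
    (\int[P]_w ((b w - a w)%N%:R * (b' w - a' w)%N%:R)%:E)%E.
Proof.
move=> mE mE'.
have := @cvg_integral_stationary _ _ _ P
  (fun K w => (\sum_(k < K) \1_(between a b k) w) *
              (\sum_(k < K) \1_(between a' b' k) w))
  (fun w => (b w - a w)%N%:R * (b' w - a' w)%N%:R).
case.
- by move=> K; apply: measurable_funM; apply: measurable_sum => i;
    exact: measurable_indic.
- move=> K w; rewrite !sum_indic_between mulr_ge0 ?ler0n//=.
  by rewrite ler_pM ?ler0n// ler_nat; lia.
- move=> w; near=> K; rewrite !sum_indic_between.
  have : (b w <= K)%N by near: K; exact: nbhs_infty_ge.
  move=> /minn_idPr ->.
  have : (b' w <= K)%N by near: K; exact: nbhs_infty_ge.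
  by move=> /minn_idPr ->.
move=> _ cf.
apply: cvg_trans cf; apply: near_eq_cvg; apply: nearW => K.
by rewrite integral_mul_sum_indic.
Unshelve. all: by end_near. Qed.

(** Both sides are limits of double tail sums, which factor term by term. *)
Lemma integral_mul_indep (X Y : T -> nat) :
  (forall k, measurable [set w | (k < X w)%N]) ->
  (forall k, measurable [set w | (k < Y w)%N]) ->
  (forall k l, fine (P ([set w | (k < X w)%N] `&` [set w | (l < Y w)%N])) =
     fine (P [set w | (k < X w)%N]) * fine (P [set w | (l < Y w)%N])) ->
  (\int[P]_w ((X w)%:R)%:E < +oo)%E -> (\int[P]_w ((Y w)%:R)%:E < +oo)%E ->
  (\int[P]_w ((X w)%:R * (Y w)%:R)%:E =
   \int[P]_w ((X w)%:R)%:E * \int[P]_w ((Y w)%:R)%:E)%E.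
Proof.
move=> mX mY indep Xoo Yoo.
have cX := @cvg_sum_between (fun=> 0%N) X mX.
have cY := @cvg_sum_between (fun=> 0%N) Y mY.
have cXY := @cvg_sum_between2 (fun=> 0%N) X (fun=> 0%N) Y mX mY.
move: cX cY cXY.
under eq_integral do rewrite subn0; move=> cX.
under eq_integral do rewrite subn0; move=> cY.
under eq_integral do rewrite !subn0; move=> cXY.
have fX : (\int[P]_w ((X w)%:R)%:E)%E \is a fin_num.
  by rewrite ge0_fin_numE//; apply: integral_ge0 => w _; rewrite lee_fin.
have fY : (\int[P]_w ((Y w)%:R)%:E)%E \is a fin_num.
  by rewrite ge0_fin_numE//; apply: integral_ge0 => w _; rewrite lee_fin.
apply: (cvg_unique _ cXY) => //.
apply: cvg_trans (cvgeM _ cX cY); last exact: mule_def_fin.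
apply: near_eq_cvg; apply: nearW => K /=; rewrite -EFinM; congr EFin.
rewrite mulr_suml; apply: eq_bigr => k _; rewrite mulr_sumr.
by apply: eq_bigr => l _; rewrite -indep.
Qed.

Lemma poisson_prob1 (L : R) k : 0 <= L ->
  poisson_prob L 0 [set k] = (L ^+ k / k`!%:R * expR (- L))%:E.
Proof.
move=> L0; rewrite /poisson_prob; case: ifPn => [Lgt0|].
  by rewrite esum_set1 ?lee_fin ?poisson_pmf_ge0// /poisson_pmf Lgt0.
rewrite -leNgt => Lle0; have -> : L = 0 by apply/eqP; rewrite eq_le Lle0.
rewrite oppr0 expR0 mulr1 diracE expr0n.
have [->|k0] := eqVneq k 0%N; first by rewrite mem_set// fact0 divr1.
by rewrite memNset ?mul0r//= => /esym/eqP; exact/negP.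
Qed.

(** Factorial moments are the natural ones here: k^_r / k! = 1 / (k - r)!, so
    the series is L^r times a shifted exponential series. *)
Lemma poisson_factorial_moment (L : R) (X : T -> nat) (r : nat) : 0 <= L ->
  (forall k, measurable [set w | X w = k]) ->
  (forall B : set nat, P [set w | B (X w)] = poisson_prob L 0 B) ->
  (\int[P]_w ((X w ^_ r)%:R)%:E = (L ^+ r)%:E)%E.
Proof.
move=> L0 mX lawX.
have fE K w : \sum_(k < K) (k ^_ r)%:R * \1_[set w | X w = k] w =
    (if (X w < K)%N then (X w ^_ r)%:R else 0) :> R.
  have indE k : \1_[set w | X w = k] w = (X w == k)%:R :> R.
    rewrite indicE; congr (nat_of_bool _)%:R.
    by apply/idP/eqP => [/set_mem//|?]; exact/mem_set.
  case: ifPn => [XK|XK].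
    rewrite (bigD1 (Ordinal XK))//= indE eqxx mulr1 big1 ?addr0// => k.
    rewrite -val_eqE /= eq_sym indE => /negPf ->; by rewrite mulr0.
  rewrite big1// => k _; rewrite indE; case: eqP => [Xk|]; last by rewrite mulr0.
  by move: XK; rewrite Xk ltn_ord.
have := @cvg_integral_stationary _ _ _ P
  (fun K w => \sum_(k < K) (k ^_ r)%:R * \1_[set w | X w = k] w)
  (fun w => (X w ^_ r)%:R).
case.
- move=> K; apply: measurable_sum => k; apply: measurable_funM => //.
- by move=> K w; rewrite fE; case: ifP; rewrite ?ler0n ?lexx.
- move=> w; near=> K; rewrite fE ifT//.
  by near: K; exact: nbhs_infty_gt.
move=> _ cf.
have {}cf : (\sum_(k < K) (k ^_ r)%:R * fine (P [set w | X w = k]))%:E @[K --> \oo]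
    --> (\int[P]_w ((X w ^_ r)%:R)%:E)%E.
  apply: cvg_trans cf; apply: near_eq_cvg; apply: nearW => K.
  rewrite (@integral_sum_indic _ _ _ P _ (fun k : 'I_K => (k ^_ r)%:R)
    (fun k : 'I_K => [set w | X w = k]))//.
have pE k : fine (P [set w | X w = k]) = L ^+ k / k`!%:R * expR (- L).
  by rewrite (lawX [set k]) poisson_prob1.
apply: (cvg_unique _ cf) => //.
(* The terms with k < r vanish. *)
rewrite /= -(cvg_shiftn r) /=.
suff sE K : \sum_(k < K + r) (k ^_ r)%:R * fine (P [set w | X w = k]) =
    L ^+ r * expR (- L) * series (exp_coeff L) K.
  under eq_fun do rewrite sE.
  have eL : L ^+ r * expR (- L) * expR L = L ^+ r.
    by rewrite -mulrA expRN mulVf ?mulr1// gt_eqF// expR_gt0.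
  have : (L ^+ r * expR (- L) * series (exp_coeff L) K)%:E @[K --> \oo] -->
      (L ^+ r * expR (- L) * expR L)%:E.
    apply: cvg_EFin_seq; apply: cvgMl_tmp.
    by rewrite /expR; exact: (is_cvg_series_exp_coeff L).
  by rewrite eL.
rewrite addnC big_split_ord /= big1 ?add0r; last first.
  by move=> k _; rewrite ffact_small ?mul0r.
rewrite /series /= mulr_sumr big_mkord; apply: eq_bigr => k _.
rewrite pE /exp_coeff /= exprD.
have /(congr1 (fun n => n%:R : R)) : ((r + k) ^_ r * (k`!) = (r + k)`!)%N.
  by rewrite -(ffact_fact (leq_addr k r)) addKn.
rewrite natrM => <-.
field.
rewrite !pnatr_eq0 -!lt0n fact_gt0 ffact_gt0 leq_addr//.
Unshelve. all: by end_near. Qed.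

End counts.

(** * Riemann sums for an exponential weight *)

Section riemann_sums.
Context (R : realType).
Notation leb := (@lebesgue_measure R).
Variables (lambda : R -> R) (t : R).
Hypotheses (t_ge0 : 0 <= t) (lambda_ge0 : forall s, 0 <= s -> 0 <= lambda s).
Hypothesis lambda_int : leb.-integrable `[0, t] (EFin \o lambda).

Definition grid (t : R) (n i : nat) : R := t * i%:R / n.+1%:R.

Definition cell_mass n i : R :=
  (\int[leb]_(s in `[grid t n i, grid t n i.+1]) lambda s)%R.

Lemma grid_ge0 n i : 0 <= grid t n i.
Proof. by rewrite /grid divr_ge0// mulr_ge0. Qed.

Lemma gridS n i : grid t n i.+1 = grid t n i + t / n.+1%:R.
Proof. by rewrite /grid -natr1; ring. Qed.

Lemma grid_nd n : nondecreasing_seq (grid t n).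
Proof.
apply/nondecreasing_seqP => i; rewrite gridS lerDl.
by rewrite divr_ge0.
Qed.

Lemma grid0 n : grid t n 0 = 0.
Proof. by rewrite /grid mulr0 mul0r. Qed.

Lemma grid_last n : grid t n n.+1 = t.
Proof. by rewrite /grid mulfK// pnatr_eq0. Qed.

Lemma grid_le n i : (i <= n.+1)%N -> grid t n i <= t.
Proof. by move=> iN; rewrite -[leRHS](grid_last n); exact: grid_nd. Qed.

Lemma integrable_lambda_expR c : 0 <= c ->
  leb.-integrable `[0, t] (EFin \o (fun s => lambda s * expR (c * s))).
Proof.
move=> c0.
have mE : measurable_fun `[0, t]%classic (fun s : R => expR (c * s)).
  by apply: measurable_funTS; apply: measurableT_comp => //; exact: measurable_funM.
suff : leb.-integrable `[0, t] ((EFin \o lambda) \* (EFin \o fun s => expR (c * s)))%E.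
  by [].
apply: integrableMl => //.
exists (expR (c * t)); split; first exact: num_real.
move=> M cM s /=; rewrite in_itv /= => /andP[s0 st].
rewrite ger0_norm ?expR_ge0//; apply/ltW/(le_lt_trans _ cM).
by rewrite ler_expR ler_wpM2l.
Qed.

Lemma Rintegral_grid (h : R -> R) n m : leb.-integrable `[0, t] (EFin \o h) ->
  (m <= n.+1)%N ->
  (\int[leb]_(s in `[0%R, grid t n m]) h s =
   \sum_(i < m) \int[leb]_(s in `[grid t n i, grid t n i.+1]) h s)%R.
Proof.
move=> hint; elim: m => [|m IH] mn.
  by rewrite big_ord0 grid0 set_itv1 Rintegral_set1.
rewrite big_ord_recr /= -IH ?(ltnW mn)//.
have sub a b : 0 <= a -> b <= t -> leb.-integrable `[a, b] (EFin \o h).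
  move=> a0 bt; apply: integrableS hint => //.
  by apply: subset_itv; rewrite bnd_simp.
have H := @Rintegral_itvB R h (BLeft 0) (BRight (grid t n m.+1)) (grid t n m).
rewrite -[LHS](subrK (\int[leb]_(s in `[0%R, grid t n m]) h s)%R) H; last 3 first.
- by apply: sub => //; exact: grid_le.
- by rewrite bnd_simp grid_ge0.
- by rewrite bnd_simp grid_nd.
have HO := @Rintegral_itv_obnd_cbnd R (grid t n m) (BRight (grid t n m.+1)) h.
rewrite HO; first exact: addrC.
apply: integrableS (sub _ _ (grid_ge0 n m) (grid_le mn)) => //.
by apply: subset_itvr; rewrite bnd_simp.
Qed.

(** The exponential weight varies on a cell by the factor exp(c t / (n + 1)),
    the same for all cells. *)
Lemma cell_bounds c n i : 0 <= c -> (i < n.+1)%N ->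
  expR (c * grid t n i) * cell_mass n i <=
    (\int[leb]_(s in `[grid t n i, grid t n i.+1]) (lambda s * expR (c * s)))%R
  <= expR (c * (t / n.+1%:R)) * (expR (c * grid t n i) * cell_mass n i).
Proof.
move=> c0 iN.
have sub h : leb.-integrable `[0, t] (EFin \o h) ->
    leb.-integrable `[grid t n i, grid t n i.+1] (EFin \o h).
  move=> hint; apply: integrableS hint => //.
  by apply: subset_itv; rewrite bnd_simp ?grid_ge0 ?grid_le.
have intl := sub _ lambda_int.
have intle := sub _ (integrable_lambda_expR c0).
have intc k : leb.-integrable `[grid t n i, grid t n i.+1]
    (EFin \o (fun s => k * lambda s)).
  by under [X in _.-integrable _ X]eq_fun do rewrite /= EFinM; exact: integrableZl.
rewrite mulrA -expRD -mulrDr [t / _ + _]addrC -gridS /cell_mass -!RintegralZl//.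
apply/andP; split; apply: le_Rintegral => // s /=; rewrite in_itv /= => /andP[s1 s2].
  rewrite mulrC ler_wpM2l ?lambda_ge0 ?(le_trans _ s1) ?grid_ge0//.
  by rewrite ler_expR ler_wpM2l.
rewrite [leRHS]mulrC ler_wpM2l ?lambda_ge0 ?(le_trans _ s1) ?grid_ge0//.
by rewrite ler_expR ler_wpM2l.
Qed.

(** By [cell_bounds] the left Riemann sum lies between J and J times
    exp(- c t / (n + 1)), where J is the integral. *)
Lemma cvg_riemann_sum c : 0 <= c ->
  \sum_(i < n.+1) expR (- c * (t - grid t n i)) * cell_mass n i @[n --> \oo] -->
  expR (- c * t) * (\int[leb]_(s in `[0%R, t]) (lambda s * expR (c * s)))%R.
Proof.
move=> c0; set J := (\int[leb]_(s in _) _)%R.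
pose S n := \sum_(i < n.+1) expR (c * grid t n i) * cell_mass n i.
have sumE n : \sum_(i < n.+1) expR (- c * (t - grid t n i)) * cell_mass n i =
    expR (- c * t) * S n.
  rewrite /S mulr_sumr; apply: eq_bigr => i _; rewrite mulrA -expRD.
  by congr (expR _ * _); ring.
under eq_fun do rewrite sumE.
apply: cvgMl_tmp.
have JE n : J = \sum_(i < n.+1)
    (\int[leb]_(s in `[grid t n i, grid t n i.+1]) (lambda s * expR (c * s)))%R.
  by rewrite -Rintegral_grid ?grid_last//; exact: integrable_lambda_expR.
have SJ n : S n <= J.
  by rewrite (JE n); apply: ler_sum => i _; case/andP: (cell_bounds c0 (ltn_ord i)).
have JS n : expR (- (c * (t / n.+1%:R))) * J <= S n.
  have -> : S n = expR (- (c * (t / n.+1%:R))) * (expR (c * (t / n.+1%:R)) * S n).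
    by rewrite mulrA -expRD addNr expR0 mul1r.
  rewrite ler_wpM2l ?expR_ge0// (JE n) /S mulr_sumr; apply: ler_sum => i _.
  by case/andP: (cell_bounds c0 (ltn_ord i)).
apply: (@squeeze_cvgr _ _ _ _ (fun n : nat => expR (- (c * (t / n.+1%:R))) * J)
   (fun=> J)); [|  |exact: cvg_cst].
  by apply: nearW => n; rewrite JS SJ.
have mesh0 : - (c * (t / n.+1%:R)) @[n --> \oo] --> (- (c * t * 0) : R).
  under eq_fun do rewrite mulrA.
  by apply: cvgN; apply: cvgMl_tmp; exact: cvg_harmonic.
rewrite mulr0 oppr0 in mesh0.
have exp1 : expR (- (c * (t / n.+1%:R))) @[n --> \oo] --> expR (0 : R).
  by apply: (continuous_cvg _ _ mesh0); exact: continuous_expR.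
rewrite expR0 in exp1.
have : expR (- (c * (t / n.+1%:R))) * J @[n --> \oo] --> 1 * J by exact: cvgMr_tmp.
by rewrite mul1r.
Qed.

End riemann_sums.

(** * Elementary events of the queue *)

Lemma sigma_of_preimage (aT : Type) d' (rT : measurableType d') (X : aT -> rT)
  (A : set rT) : measurable A -> sigma_of X (X @^-1` A).
Proof. by move=> mA; exists A => //; rewrite setTI. Qed.

(** The exponential law is known through its mass on segments [0, s]; the
    negative half-line is negligible because the density vanishes there. *)
Lemma exponential_tail d (T : measurableType d) (R : realType)
    (P : probability T R) (X : {RV P >-> R}) (mu s : R) : 0 <= s ->
  (forall A, measurable A -> distribution P X A = exponential_prob mu A) ->
  fine (P [set w | s < X w]) = expR (- mu * s).
Proof.
move=> s0 lawX.
have neg : (P (X @^-1` `]-oo, 0%R[) = 0)%E.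
  rewrite -[LHS]/(distribution P X `]-oo, 0%R[%classic) lawX//.
  apply: integral0_eq => x.
  rewrite /= in_itv/= => x0.
  rewrite /exponential_pdf patchE memNset//= in_itv/= andbT.
  by apply/negP; rewrite -ltNge.
have pos : (P (X @^-1` `[0%R, s]) = 1 - (expR (- mu * s))%:E)%E.
  rewrite -[LHS]/(distribution P X `[0%R, s]%classic) lawX//.
  move: s0; rewrite le_eqVlt => /predU1P[<-|s0].
    by rewrite set_itv1 /exponential_prob integral_set1 mulr0 expR0 subee.
  exact: exponential_prob_itv0c.
have le : (P (X @^-1` `]-oo, s]) = 1 - (expR (- mu * s))%:E)%E.
  have -> : `]-oo, s]%classic = `]-oo, 0[%classic `|` `[0, s]%classic :> set R.
    by apply: itv_bndbnd_setU; rewrite ?bnd_simp.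
  rewrite preimage_setU measureU; first exact: (eq_trans (f_equal2 _ neg pos) (add0e _)).
  - exact: measurable_funPTI.
  - exact: measurable_funPTI.
  apply/seteqP; split => // w [/=]; rewrite !in_itv/= => x0 /andP[].
  by rewrite leNgt x0.
have -> : [set w | s < X w] = ~` (X @^-1` `]-oo, s]).
  by apply/seteqP; split => w /=; rewrite in_itv/= ltNge => /negP.
rewrite probability_setC; last exact: measurable_funPTI.
by rewrite le /=; ring.
Qed.

(** Equality of sources is decided classically, so it computes to a case
    analysis on an equality between constructor applications. *)
Ltac distinct_sources :=
  rewrite !cons_uniq ?in_cons ?in_nil ?negb_or; repeat (apply/andP; split);
  first [by [] | by case: pselect => // ?; congruence].

Section events.
Context d (T : measurableType d) (R : realType) (P : probability T R).
Context (lambda : R -> R) (mu : R) (N : {RV P >-> nat}) (q0 : nat).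
Context (Q : infinite_server_queue lambda mu N q0) (t : R).
Hypothesis t_ge0 : 0 <= t.

Definition arrive n i k : set T :=
  between (arrivals Q (grid t n i)) (arrivals Q (grid t n i.+1)) k.
Definition has_member k j : set T := [set w | (j < batch Q k w)%N].
Definition stays s k j : set T := [set w | s < service Q k j w].
Definition initial_stays j : set T := [set w | t < initial Q j w].
(** Customer j of batch k arrives during cell i and is still present at time t
    when its arrival is moved back to the beginning of the cell. Replacing the
    random epoch by a constant makes this an intersection of events of three
    independent sources. *)
Definition present n i k j : set T :=
  arrive n i k `&` (has_member k j `&` stays (t - grid t n i) k j).

Definition batch_tail j : set T := [set w | (j < N w)%N].
(** The probability to be present at time t when arriving at the left end of
    cell i. *)
Definition survival n i : R := expR (- mu * (t - grid t n i)).

Lemma measurable_arrive n i k : measurable (arrive n i k).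
Proof.
rewrite (_ : arrive n i k = (arrivals Q (grid t n i) @^-1` [set m | (m <= k)%N]) `&`
  (arrivals Q (grid t n i.+1) @^-1` [set m | (k < m)%N])).
  by apply: measurableI; exact: measurable_funPTI.
by apply/seteqP; split => w; rewrite /arrive /between/= => /andP.
Qed.

Lemma measurable_has_member k j : measurable (has_member k j).
Proof. exact: (measurable_funPTI (batch Q k) (Y := [set m | (j < m)%N])). Qed.

Lemma measurable_batch_tail j : measurable (batch_tail j).
Proof. exact: (measurable_funPTI N (Y := [set m | (j < m)%N])). Qed.

Lemma measurable_gt (s : R) : measurable [set x : R | s < x].
Proof. by rewrite -set_itvoy. Qed.

Lemma measurable_stays s k j : measurable (stays s k j).
Proof. exact: (measurable_funPTI (service Q k j) (measurable_gt s)). Qed.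

Lemma measurable_initial_stays j : measurable (initial_stays j).
Proof. exact: (measurable_funPTI (initial Q j) (measurable_gt t)). Qed.

Lemma measurable_present n i k j : measurable (present n i k j).
Proof.
apply: measurableI; first exact: measurable_arrive.
by apply: measurableI; [exact: measurable_has_member|exact: measurable_stays].
Qed.

Lemma prob_has_member k (A : set nat) :
  P (batch Q k @^-1` A) = P (N @^-1` A).
Proof. exact: (batchP Q k A). Qed.

Lemma prob_stays n i k j : (i <= n.+1)%N ->
  fine (P (stays (t - grid t n i) k j)) = survival n i.
Proof.
move=> iN.
apply: exponential_tail.
  by rewrite subr_ge0 grid_le.
by move=> A mA; exact: serviceP.
Qed.

Lemma prob_initial_stays j : fine (P (initial_stays j)) = expR (- mu * t).
Proof.
apply: exponential_tail => //.
by move=> A mA; exact: initialP.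
Qed.

Local Notation sources :=
  (source_sigma (arrivals Q) (batch Q) (service Q) (initial Q)).

(** The arrival source is generated by all the counting variables, so it is
    closed under the intersection of the two events that define [arrive]. *)
Lemma arrive_sigma n i k : sources (Arrivals q0) (arrive n i k).
Proof.
pose G := \bigcup_(s in `[0, +oo[) sigma_of (arrivals Q s).
have sigma_arr s (A : set nat) : 0 <= s ->
    @measurable _ (g_sigma_algebraType G) (arrivals Q s @^-1` A).
  move=> s0; apply: sub_sigma_algebra; exists s.
    by rewrite /= in_itv/= s0.
  exact: sigma_of_preimage.
suff : @measurable _ (g_sigma_algebraType G) (arrive n i k) by [].
rewrite (_ : arrive n i k = (arrivals Q (grid t n i) @^-1` [set m | (m <= k)%N]) `&`
  (arrivals Q (grid t n i.+1) @^-1` [set m | (k < m)%N])).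
  by apply: measurableI; apply: sigma_arr; exact: grid_ge0.
by apply/seteqP; split => w; rewrite /arrive /between/= => /andP.
Qed.

Lemma arrive2_sigma n i k i' k' :
  sources (Arrivals q0) (arrive n i k `&` arrive n i' k').
Proof.
pose G := \bigcup_(s in `[0, +oo[) sigma_of (arrivals Q s).
suff : @measurable _ (g_sigma_algebraType G) (arrive n i k `&` arrive n i' k') by [].
by apply: measurableI; exact: arrive_sigma.
Qed.

Lemma has_member_sigma k j : sources (Batch q0 k) (has_member k j).
Proof. exact: (@sigma_of_preimage _ _ _ (batch Q k) [set m | (j < m)%N]). Qed.

Lemma has_member2_sigma k j j' :
  sources (Batch q0 k) (has_member k j `&` has_member k j').
Proof.
exact: (@sigma_of_preimage _ _ _ (batch Q k)
  ([set m | (j < m)%N] `&` [set m | (j' < m)%N])).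
Qed.

Lemma stays_sigma s k j : sources (Service q0 k j) (stays s k j).
Proof. exact: (@sigma_of_preimage _ _ _ (service Q k j) _ (measurable_gt s)). Qed.

Lemma initial_stays_sigma j : sources (Initial j) (initial_stays j).
Proof. exact: (@sigma_of_preimage _ _ _ (initial Q j) _ (measurable_gt t)). Qed.

Let sources_indep (xs : seq (source q0)) (Es : seq (set T)) := 
  @mutually_independent_seq _ _ _ P _ _ xs Es (Arrivals q0) (@sourcesP _ _ _ _ _ _ _ _ Q).

Lemma prob_present n i k j : (i <= n.+1)%N ->
  fine (P (present n i k j)) =
  fine (P (arrive n i k)) * fine (P (batch_tail j)) * survival n i.
Proof.
move=> iN; rewrite -(prob_stays k j iN) -(prob_has_member k [set m | (j < m)%N]).
have := @sources_indep [:: Arrivals q0; Batch q0 k; Service q0 k j]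
  [:: arrive n i k; has_member k j; stays (t - grid t n i) k j].
rewrite !big_cons !big_nil setIT mulr1 mulrA; apply => //.
- by distinct_sources.
- by case=> [|[|[|]]]//= _; [exact: arrive_sigma|exact: has_member_sigma|
    exact: stays_sigma].
- by case=> [|[|[|[]]]]//=; [exact: measurable_arrive|exact: measurable_has_member|
    exact: measurable_stays].
Qed.

Lemma prob_present_diff_batch n i k j i' k' j' :
  (i <= n.+1)%N -> (i' <= n.+1)%N -> k != k' ->
  fine (P (present n i k j `&` present n i' k' j')) =
  fine (P (arrive n i k `&` arrive n i' k')) *
  (fine (P (batch_tail j)) * fine (P (batch_tail j'))) *
  (survival n i * survival n i').
Proof.
move=> iN iN' kk'; rewrite -(prob_stays k j iN) -(prob_stays k' j' iN').
rewrite -(prob_has_member k [set m | (j < m)%N]).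
rewrite -(prob_has_member k' [set m | (j' < m)%N]).
have := @sources_indep
  [:: Arrivals q0; Batch q0 k; Batch q0 k'; Service q0 k j; Service q0 k' j']
  [:: arrive n i k `&` arrive n i' k'; has_member k j; has_member k' j';
      stays (t - grid t n i) k j; stays (t - grid t n i') k' j'].
rewrite !big_cons !big_nil setIT mulr1 => H.
rewrite (_ : present n i k j `&` present n i' k' j' = arrive n i k `&` arrive n i' k'
  `&` (has_member k j `&` (has_member k' j' `&` (stays (t - grid t n i) k j `&`
    stays (t - grid t n i') k' j')))); last first.
  by apply/seteqP; split => w; rewrite /present/setI/=; tauto.
rewrite H; first by rewrite !mulrA.
- by move/eqP: kk' => kk'; distinct_sources.
- by [].
- by case=> [|[|[|[|[|]]]]]//= _; [exact: arrive2_sigma|exact: has_member_sigma|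
    exact: has_member_sigma|exact: stays_sigma|exact: stays_sigma].
- by case=> [|[|[|[|[|[]]]]]]//=; [apply: measurableI; exact: measurable_arrive|
    exact: measurable_has_member|exact: measurable_has_member|
    exact: measurable_stays|exact: measurable_stays].
Qed.

(** Two members of one batch share the batch size, whence the joint tail of N
    where two different batches give a product of tails. *)
Lemma prob_present_same_batch n i k j j' : (i <= n.+1)%N -> j != j' ->
  fine (P (present n i k j `&` present n i k j')) =
  fine (P (arrive n i k)) * fine (P (batch_tail j `&` batch_tail j')) *
  survival n i ^+ 2.
Proof.
move=> iN jj'; rewrite expr2 -{1}(prob_stays k j iN) -(prob_stays k j' iN).
rewrite -(prob_has_member k ([set m | (j < m)%N] `&` [set m | (j' < m)%N])).
have := @sources_indep
  [:: Arrivals q0; Batch q0 k; Service q0 k j; Service q0 k j']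
  [:: arrive n i k; has_member k j `&` has_member k j';
      stays (t - grid t n i) k j; stays (t - grid t n i) k j'].
rewrite !big_cons !big_nil setIT mulr1 => H.
rewrite (_ : present n i k j `&` present n i k j' = arrive n i k
  `&` (has_member k j `&` has_member k j' `&` (stays (t - grid t n i) k j `&`
    stays (t - grid t n i) k j'))); last first.
  by apply/seteqP; split => w; rewrite /present/setI/=; tauto.
rewrite H; first by rewrite !mulrA.
- by move/eqP: jj' => jj'; distinct_sources.
- by [].
- by case=> [|[|[|[|]]]]//= _; [exact: arrive_sigma|exact: has_member2_sigma|
    exact: stays_sigma|exact: stays_sigma].
- by case=> [|[|[|[|[]]]]]//=; [exact: measurable_arrive|
    apply: measurableI; exact: measurable_has_member|
    exact: measurable_stays|exact: measurable_stays].
Qed.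

Lemma prob_initial_present n i k j j0 : (i <= n.+1)%N ->
  fine (P (initial_stays j0 `&` present n i k j)) =
  expR (- mu * t) * fine (P (present n i k j)).
Proof.
move=> iN; rewrite (prob_present _ _ iN) -(prob_initial_stays j0).
rewrite -(prob_stays k j iN) -(prob_has_member k [set m | (j < m)%N]).
have := @sources_indep [:: Initial j0; Arrivals q0; Batch q0 k; Service q0 k j]
  [:: initial_stays j0; arrive n i k; has_member k j; stays (t - grid t n i) k j].
rewrite !big_cons !big_nil setIT mulr1 => H.
rewrite H; first by rewrite !mulrA.
- by distinct_sources.
- by [].
- by case=> [|[|[|[|]]]]//= _; [exact: initial_stays_sigma|exact: arrive_sigma|
    exact: has_member_sigma|exact: stays_sigma].
- by case=> [|[|[|[|[]]]]]//=; [exact: measurable_initial_stays|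
    exact: measurable_arrive|exact: measurable_has_member|exact: measurable_stays].
Qed.

Lemma prob_initial2 j j' : j != j' ->
  fine (P (initial_stays j `&` initial_stays j')) = expR (- mu * t) ^+ 2.
Proof.
move=> jj'; rewrite expr2 -{1}(prob_initial_stays j) -(prob_initial_stays j').
have := @sources_indep [:: Initial j; Initial j']
  [:: initial_stays j; initial_stays j'].
rewrite !big_cons !big_nil setIT mulr1; apply => //.
- by move/eqP: jj' => jj'; distinct_sources.
- by case=> [|[|]]//= _; exact: initial_stays_sigma.
- by case=> [|[|[]]]//=; exact: measurable_initial_stays.
Qed.

Lemma arrive_disjoint n i i' k : i != i' ->
  arrive n i k `&` arrive n i' k = set0.
Proof.
wlog ii' : i i' / (i < i')%N.
  move=> H ne; have [l|l|e] := ltngtP i i'; first exact: H.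
  - by rewrite setIC; apply: H => //; rewrite eq_sym.
  - by rewrite e eqxx in ne.
move=> _; apply/seteqP; split => // w [/andP[_ h1] /andP[h2 _]].
have := poisson_mono (arrivalsP Q) w (grid_ge0 t_ge0 n i.+1) (grid_nd t_ge0 n ii').
by rewrite leqNgt (leq_ltn_trans h2 h1).
Qed.

End events.

(** * Moments of the truncated discretised count *)

Lemma sum_delta (R : pzRingType) (I : finType) (i : I) (F : I -> R) :
  \sum_j (i == j)%:R * F j = F i.
Proof.
rewrite (bigD1 i)//= eqxx mul1r big1 ?addr0// => j.
by rewrite eq_sym => /negPf ->; rewrite mul0r.
Qed.

Lemma sum_triple2 (R : nmodType) (I J K : finType) (F : I * J * K -> I * J * K -> R) :
  \sum_x \sum_y F x y =
  \sum_i \sum_i' \sum_j \sum_j' \sum_k \sum_k' F (i, j, k) (i', j', k').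
Proof.
have triple (G : I * J * K -> R) : \sum_x G x = \sum_i \sum_j \sum_k G (i, j, k).
  rewrite (eq_bigr (fun p => G (p.1, p.2))); last by case.
  rewrite -(pair_bigA _ (fun ij k => G (ij, k))) /=.
  rewrite (eq_bigr (fun p => \sum_k G (p.1, p.2, k))); last by case.
  by rewrite -(pair_bigA _ (fun i j => \sum_k G (i, j, k))).
rewrite triple; apply: eq_bigr => i _.
under eq_bigr => j _ do under eq_bigr => k _ do rewrite triple.
under eq_bigr => j _ do rewrite exchange_big /=.
rewrite exchange_big /=; apply: eq_bigr => i' _; apply: eq_bigr => j _.
by rewrite exchange_big.
Qed.

Section moments.
Context d (T : measurableType d) (R : realType) (P : probability T R).
Context (lambda : R -> R) (mu : R) (N : {RV P >-> nat}) (q0 : nat).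
Context (Q : infinite_server_queue lambda mu N q0) (t : R).
Hypothesis t_ge0 : 0 <= t.

Local Notation arrive := (arrive Q t).
Local Notation survival := (survival mu t).
Local Notation p0 := (expR (- mu * t)).

(** E[min(N, K)], the mean size of a truncated batch. *)
Definition tail1 K : R := \sum_(j < K) fine (P (batch_tail N j)).
(** E[min(N, K)^2]. *)
Definition tail2 K : R :=
  \sum_(j < K) \sum_(j' < K) fine (P (batch_tail N j `&` batch_tail N j')).
(** The mean number of arrivals in cell i among the first K. *)
Definition arrivals1 n K i : R := \sum_(k < K) fine (P (arrive n i k)).
(** The mixed second moment of the numbers of arrivals in cells i and i' among
    the first K. *)
Definition arrivals2 n K i i' : R :=
  \sum_(k < K) \sum_(k' < K) fine (P (arrive n i k `&` arrive n i' k')).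

Definition presence n K (x : 'I_q0 + 'I_n.+1 * 'I_K * 'I_K) : set T :=
  match x with
  | inl j => initial_stays Q t j
  | inr y => present Q t n y.1.1 y.1.2 y.2
  end.

Definition truncated_count n K (w : T) : R := \sum_x \1_(@presence n K x) w.

Lemma measurable_presence n K x : measurable (@presence n K x).
Proof.
by case: x => [j|y]; [exact: measurable_initial_stays|exact: measurable_present].
Qed.

Lemma sum_present n K :
  \sum_(y : 'I_n.+1 * 'I_K * 'I_K) fine (P (present Q t n y.1.1 y.1.2 y.2)) =
  tail1 K * \sum_(i < n.+1) survival n i * arrivals1 n K i.
Proof.
rewrite -(pair_bigA _ (fun (ik : 'I_n.+1 * 'I_K) (j : 'I_K) =>
  fine (P (present Q t n ik.1 ik.2 j)))).
rewrite -(pair_bigA _ (fun (i : 'I_n.+1) (k : 'I_K) =>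
  \sum_(j < K) fine (P (present Q t n i k j)))).
rewrite mulr_sumr /=; apply: eq_bigr => i _.
rewrite /arrivals1 !mulr_sumr; apply: eq_bigr => k _.
rewrite /tail1 mulr_suml; apply: eq_bigr => j _.
by rewrite prob_present// ?(ltnW (ltn_ord i))//; ring.
Qed.

(** One formula for all pairs, written so that each summand is a product of a
    factor in the arrival indices (k, k') and a factor in the member indices
    (j, j'): pairs from different batches first, then the corrections for
    pairs in one batch, which must be in one cell, and for equal customers. *)
Lemma prob_present2 n (i i' : 'I_n.+1) k k' j j' :
  fine (P (present Q t n i k j `&` present Q t n i' k' j')) =
  (fine (P (arrive n i k `&` arrive n i' k')) -
    (k == k')%:R * ((i == i')%:R * fine (P (arrive n i k)))) *
    (survival n i * survival n i') *
    (fine (P (batch_tail N j)) * fine (P (batch_tail N j'))) +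
  (k == k')%:R * ((i == i')%:R * fine (P (arrive n i k))) *
    (fine (P (batch_tail N j `&` batch_tail N j')) * survival n i ^+ 2 +
     (j == j')%:R *
      (fine (P (batch_tail N j)) * (survival n i - survival n i ^+ 2))).
Proof.
have iN := ltnW (ltn_ord i); have iN' := ltnW (ltn_ord i').
have [<-|kk'] := eqVneq k k'; last first.
  by rewrite prob_present_diff_batch// !mul0r; ring.
have [<-|ii'] := eqVneq i i'; last first.
  rewrite (arrive_disjoint Q t_ge0)// (_ : _ `&` _ = set0).
    by rewrite measure0 /=; ring.
  apply/seteqP; split => // w [[ai _] [ai' _]].
  by rewrite -(arrive_disjoint Q t_ge0 n k ii').
rewrite setIid; have [<-|jj'] := eqVneq j j'.
  by rewrite !setIid prob_present// !mul1r; ring.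
by rewrite prob_present_same_batch// !mul1r mul0r; ring.
Qed.

(** The expected number of pairs of distinct batches is arrivals2 minus its
    diagonal, and each has weight tail1 squared; a single batch contributes
    tail1 for equal customers and tail2 - tail1 for distinct ones. *)
Lemma sum_present2 n K :
  \sum_(x : 'I_n.+1 * 'I_K * 'I_K) \sum_(y : 'I_n.+1 * 'I_K * 'I_K)
    fine (P (present Q t n x.1.1 x.1.2 x.2 `&` present Q t n y.1.1 y.1.2 y.2)) =
  tail1 K ^+ 2 * \sum_(i < n.+1) \sum_(i' < n.+1) survival n i * survival n i' *
     (arrivals2 n K i i' - (i == i')%:R * arrivals1 n K i) +
  \sum_(i < n.+1) arrivals1 n K i *
     (tail1 K * survival n i + (tail2 K - tail1 K) * survival n i ^+ 2).
Proof.
rewrite sum_triple2 /= mulr_sumr -big_split /=; apply: eq_bigr => i _.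
rewrite mulr_sumr.
rewrite -[X in _ + X](sum_delta i (fun i' => arrivals1 n K i' *
  (tail1 K * survival n i' + (tail2 K - tail1 K) * survival n i' ^+ 2))).
rewrite -big_split /=; apply: eq_bigr => i' _.
under eq_bigr => k _ do under eq_bigr => k' _ do
  under eq_bigr => j _ do under eq_bigr => j' _ do rewrite prob_present2.
(* Sum over the member indices. *)
have tails (a c e f : R) :
    \sum_(j < K) \sum_(j' < K)
      (a * (fine (P (batch_tail N j)) * fine (P (batch_tail N j'))) +
       c * (fine (P (batch_tail N j `&` batch_tail N j')) * e +
         (j == j')%:R * (fine (P (batch_tail N j)) * f))) =
    a * tail1 K ^+ 2 + c * (tail2 K * e + tail1 K * f).
  rewrite expr2 /tail1 /tail2.
  rewrite !mulr_suml !mulr_sumr -big_split mulr_sumr -big_split /=.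
  apply: eq_bigr => j _.
  rewrite !mulr_suml !mulr_sumr mulrDr mulr_sumr.
  have diag := sum_delta j (fun=> fine (P (batch_tail N j)) * f).
  rewrite -[in RHS]diag mulr_sumr -!big_split /=; apply: eq_bigr => j' _.
  by ring.
(* Sum over the batch indices. *)
have arrs (c e : R) :
    \sum_(k < K) \sum_(k' < K)
      ((fine (P (arrive n i k `&` arrive n i' k')) -
         (k == k' :> nat)%:R * ((i == i')%:R * fine (P (arrive n i k)))) * c +
       (k == k' :> nat)%:R * ((i == i')%:R * fine (P (arrive n i k))) * e) =
    (arrivals2 n K i i' - (i == i')%:R * arrivals1 n K i) * c +
      (i == i')%:R * (arrivals1 n K i * e).
  rewrite mulrBl /arrivals1 /arrivals2 !mulr_suml !mulr_sumr !mulr_suml.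
  rewrite -sumrB -big_split /=.
  apply: eq_bigr => k _.
  rewrite mulr_suml.
  rewrite -[(i == i')%:R * fine (P (arrive n i k)) * c](sum_delta k
    (fun=> (i == i')%:R * fine (P (arrive n i k)) * c)).
  rewrite -[(i == i')%:R * (fine (P (arrive n i k)) * e)](sum_delta k
    (fun=> (i == i')%:R * (fine (P (arrive n i k)) * e))).
  rewrite -sumrB -big_split /=; apply: eq_bigr => k' _.
  by rewrite (val_eqE k k'); ring.
transitivity (\sum_(k < K) \sum_(k' < K)
  ((fine (P (arrive n i k `&` arrive n i' k')) -
         (k == k' :> nat)%:R * ((i == i')%:R * fine (P (arrive n i k)))) *
   (survival n i * survival n i' * tail1 K ^+ 2) +
  (k == k' :> nat)%:R * ((i == i')%:R * fine (P (arrive n i k))) *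
   (tail2 K * survival n i ^+ 2 + tail1 K * (survival n i - survival n i ^+ 2)))).
  apply: eq_bigr => k _; apply: eq_bigr => k' _.
  by rewrite tails; ring.
rewrite arrs; case: eqP => [<-|_]; first by rewrite !mul1r; ring.
by rewrite !mul0r; ring.
Qed.

Lemma sum_initial2 :
  \sum_(j < q0) \sum_(j' < q0)
    fine (P (initial_stays Q t j `&` initial_stays Q t j')) =
  q0%:R * p0 + (q0%:R ^+ 2 - q0%:R) * p0 ^+ 2.
Proof.
transitivity (\sum_(j < q0) \sum_(j' < q0) (p0 ^+ 2 + (j == j')%:R * (p0 - p0 ^+ 2))).
  apply: eq_bigr => j _; apply: eq_bigr => j' _.
  have [<-|jj'] := eqVneq j j'.
    by rewrite setIid prob_initial_stays// mul1r; ring.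
  by rewrite prob_initial2// mul0r; ring.
under eq_bigr => j _ do rewrite big_split /= (sum_delta j (fun=> p0 - p0 ^+ 2)).
by rewrite !sumr_const !card_ord; ring.
Qed.

Lemma truncated_count_mean n K :
  (\int[P]_w (truncated_count n K w)%:E = (q0%:R * p0 +
    tail1 K * \sum_(i < n.+1) survival n i * arrivals1 n K i)%:E)%E.
Proof.
rewrite integral_sum_indic_unit; last exact: measurable_presence.
rewrite big_sumType /= sum_present; congr (_ + _)%:E.
under eq_bigr do rewrite prob_initial_stays//.
by rewrite sumr_const card_ord mulr_natl.
Qed.

(** The cross terms between initial and arriving customers factor by
    independence, which gives the middle summand. *)
Lemma truncated_count_second_moment n K :
  (\int[P]_w (truncated_count n K w ^+ 2)%:E = (q0%:R * p0 +
    (q0%:R ^+ 2 - q0%:R) * p0 ^+ 2 +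
    2 * (q0%:R * p0) * (tail1 K * \sum_(i < n.+1) survival n i * arrivals1 n K i) +
    (tail1 K ^+ 2 * \sum_(i < n.+1) \sum_(i' < n.+1) survival n i * survival n i' *
     (arrivals2 n K i i' - (i == i')%:R * arrivals1 n K i) +
    \sum_(i < n.+1) arrivals1 n K i *
     (tail1 K * survival n i + (tail2 K - tail1 K) * survival n i ^+ 2)))%:E)%E.
Proof.
under eq_integral do rewrite expr2.
rewrite integral_mul_sum_indic; try exact: measurable_presence.
congr EFin.
rewrite big_sumType /=.
under eq_bigr do rewrite big_sumType /=.
under [X in _ + X]eq_bigr do rewrite big_sumType /=.
rewrite !big_split /= sum_initial2 sum_present2 addrA; congr (_ + _).
rewrite -!addrA; congr (_ + (_ + _)).
rewrite [X in _ + X]exchange_big /=.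
rewrite [X in _ + X](eq_bigr (fun j : 'I_q0 => \sum_(y : 'I_n.+1 * 'I_K * 'I_K)
   fine (P (initial_stays Q t j `&` present Q t n y.1.1 y.1.2 y.2)))); last first.
  by move=> j _; apply: eq_bigr => y _; rewrite setIC.
have -> : \sum_(j < q0) \sum_(y : 'I_n.+1 * 'I_K * 'I_K)
   fine (P (initial_stays Q t j `&` present Q t n y.1.1 y.1.2 y.2)) =
   q0%:R * p0 * (tail1 K * \sum_(i < n.+1) survival n i * arrivals1 n K i).
  rewrite -sum_present.
  transitivity (\sum_(j < q0) p0 * \sum_(y : 'I_n.+1 * 'I_K * 'I_K)
    fine (P (present Q t n y.1.1 y.1.2 y.2))).
    apply: eq_bigr => j _; rewrite mulr_sumr; apply: eq_bigr => y _.
    by rewrite prob_initial_present// (ltnW (ltn_ord _)).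
  by rewrite sumr_const card_ord; ring.
by ring.
Qed.

End moments.

(** * Removing the truncation *)

Lemma cvg_fine_seq (R : realType) (u : nat -> R) (l : R) :
  (u n)%:E @[n --> \oo] --> l%:E -> u n @[n --> \oo] --> l.
Proof. by move=> ul; exact: (fine_cvg ul). Qed.

Lemma cvg_sum_ord (R : realType) (I : finType) (u : I -> nat -> R) (l : I -> R) :
  (forall i, u i n @[n --> \oo] --> l i) ->
  \sum_i u i n @[n --> \oo] --> \sum_i l i.
Proof. by move=> ul; apply: cvg_big => //; exact: add_continuous. Qed.

Section increments.
Context d (T : measurableType d) (R : realType) (P : probability T R).
Context (lambda : R -> R) (M : R -> {RV P >-> nat}).
Hypothesis poissonM : poisson_process lambda M.
Hypothesis lambda_ge0 : forall s, 0 <= s -> 0 <= lambda s.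
Variable t : R.
Hypothesis t_ge0 : 0 <= t.

Definition increment n i (w : T) : nat := (M (grid t n i.+1) w - M (grid t n i) w)%N.

Lemma measurable_increment n i (A : set nat) : measurable (increment n i @^-1` A).
Proof.
have mX : measurable_fun setT (increment n i) by exact: measurable_fun_subn.
by rewrite -[_ @^-1` _]setTI; exact: mX.
Qed.

Lemma cell_mass_ge0 n i : 0 <= cell_mass lambda t n i.
Proof.
apply: Rintegral_ge0 => s /=; rewrite in_itv/= => /andP[s1 _].
by apply: lambda_ge0; apply: le_trans s1; exact: grid_ge0.
Qed.

Lemma increment_factorial_moment n i r :
  (\int[P]_w ((increment n i w ^_ r)%:R)%:E = (cell_mass lambda t n i ^+ r)%:E)%E.
Proof.
apply: poisson_factorial_moment => [|k|B].
- exact: cell_mass_ge0.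
- exact: (measurable_increment n i [set k]).
- by apply: (poisson_increments poissonM); [exact: grid_ge0|exact: grid_nd].
Qed.

Lemma increment_mean n i :
  (\int[P]_w ((increment n i w)%:R)%:E = (cell_mass lambda t n i)%:E)%E.
Proof.
rewrite -[RHS](increment_factorial_moment n i 1).
by under [RHS]eq_integral do rewrite ffactn1.
Qed.

(** For equal cells the second moment is the second factorial moment plus the
    mean, which produces the diagonal term. *)
Lemma increment_mean_mul n i i' :
  (\int[P]_w ((increment n i w)%:R * (increment n i' w)%:R)%:E =
   (cell_mass lambda t n i * cell_mass lambda t n i' +
    (i == i')%:R * cell_mass lambda t n i)%:E)%E.
Proof.
have [<-|ii'] := eqVneq i i'.
  rewrite mul1r -expr2 EFinD -(increment_mean n i) -(increment_factorial_moment n i 2).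
  have mX k : measurable_fun setT (fun w => ((increment n i w ^_ k)%:R)%:E : \bar R).
    move=> _ A mA; rewrite setTI.
    exact: (measurable_increment n i ((fun m => ((m ^_ k)%:R)%:E) @^-1` A)).
  have -> : (\int[P]_w ((increment n i w)%:R)%:E =
      \int[P]_w ((increment n i w ^_ 1)%:R)%:E)%E.
    by apply: eq_integral => w _; rewrite ffactn1.
  rewrite -ge0_integralD//; try by move=> w _; rewrite lee_fin.
  apply: eq_integral => w _; rewrite -EFinD -natrM -natrD; congr (_%:R)%:E.
  rewrite ffactnS !ffactn1; case: (increment n i w) => // x.
  by rewrite mulnSr addnC mulnC.
rewrite mul0r addr0 EFinM -!increment_mean; apply: integral_mul_indep.
- by move=> k; exact: (measurable_increment n i [set m | (k < m)%N]).
- by move=> k; exact: (measurable_increment n i' [set m | (k < m)%N]).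
- move=> k l.
  have := @mutually_independent_seq _ _ _ P _
    (fun i => sigma_of (increment n i)) [:: i; i']
    [:: [set w | (k < increment n i w)%N]; [set w | (l < increment n i' w)%N]] 0%N.
  rewrite !big_cons !big_nil setIT mulr1; apply => //.
  + apply: (poisson_indep_increments poissonM); first by rewrite grid_ge0.
    exact: grid_nd.
  + by rewrite /= inE ii'.
  + case=> [|[|]]//= _.
    * exact: (@sigma_of_preimage _ _ _ (increment n i) [set m | (k < m)%N]).
    * exact: (@sigma_of_preimage _ _ _ (increment n i') [set m | (l < m)%N]).
  + case=> [|[|[|]]]//=.
    * exact: (measurable_increment n i [set m | (k < m)%N]).
    * exact: (measurable_increment n i' [set m | (l < m)%N]).
- by rewrite increment_mean ltry.
- by rewrite increment_mean ltry.
Qed.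

End increments.

Section limits.
Context d (T : measurableType d) (R : realType) (P : probability T R).
Context (lambda : R -> R) (mu : R) (N : {RV P >-> nat}) (q0 : nat).
Context (Q : infinite_server_queue lambda mu N q0) (t : R).
Hypothesis t_ge0 : 0 <= t.
Hypothesis lambda_ge0 : forall s, 0 <= s -> 0 <= lambda s.

Local Notation survival := (survival mu t).
Local Notation mass := (cell_mass lambda t).
Local Notation p0 := (expR (- mu * t)).

Lemma cvg_arrivals1 n i :
  arrivals1 Q t n K i @[K --> \oo] --> mass n i.
Proof.
apply: cvg_fine_seq; rewrite -(increment_mean (arrivalsP Q) lambda_ge0 t_ge0).
exact: (@cvg_sum_between _ _ _ P _ _ (measurable_arrive Q t n i)).
Qed.

Lemma cvg_arrivals2 n i i' :
  arrivals2 Q t n K i i' @[K --> \oo] -->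
  mass n i * mass n i' + (i == i')%:R * mass n i.
Proof.
apply: cvg_fine_seq; rewrite -(increment_mean_mul (arrivalsP Q) lambda_ge0 t_ge0).
exact: (@cvg_sum_between2 _ _ _ P _ _ _ _ (measurable_arrive Q t n i)
  (measurable_arrive Q t n i')).
Qed.

Lemma cvg_tail1 (m1 : R) : (\int[P]_w ((N w)%:R)%:E = m1%:E)%E ->
  tail1 N K @[K --> \oo] --> m1.
Proof.
move=> m1E; apply: cvg_fine_seq; rewrite -m1E.
have := @cvg_sum_between _ _ _ P (fun=> 0%N) N (measurable_batch_tail N).
by under eq_integral do rewrite subn0.
Qed.

Lemma cvg_tail2 (m2 : R) : (\int[P]_w ((N w)%:R ^+ 2)%:E = m2%:E)%E ->
  tail2 N K @[K --> \oo] --> m2.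
Proof.
move=> m2E; apply: cvg_fine_seq; rewrite -m2E.
have := @cvg_sum_between2 _ _ _ P (fun=> 0%N) N (fun=> 0%N) N
  (measurable_batch_tail N) (measurable_batch_tail N).
by under eq_integral do rewrite subn0 -expr2.
Qed.

Lemma cvg_truncated_count_mean n m1 : (\int[P]_w ((N w)%:R)%:E = m1%:E)%E ->
  (\int[P]_w (truncated_count Q t n K w)%:E)%E @[K --> \oo] -->
  (q0%:R * p0 + m1 * \sum_(i < n.+1) survival n i * mass n i)%:E.
Proof.
move=> m1E; under eq_fun do rewrite truncated_count_mean//.
apply: cvg_EFin_seq; apply: cvgD; first exact: cvg_cst.
apply: cvgM; first exact: cvg_tail1.
by apply: cvg_sum_ord => i; apply: cvgMl_tmp; exact: cvg_arrivals1.
Qed.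

(** The diagonal of the Poisson second moments cancels against the pairs of
    equal batches, so that distinct batches contribute exactly the square of
    the mean; the limit is displayed as that square plus the variance. *)
Lemma cvg_truncated_count_second_moment n m1 m2 :
  (\int[P]_w ((N w)%:R)%:E = m1%:E)%E ->
  (\int[P]_w ((N w)%:R ^+ 2)%:E = m2%:E)%E ->
  (\int[P]_w (truncated_count Q t n K w ^+ 2)%:E)%E @[K --> \oo] -->
  ((q0%:R * p0 + m1 * \sum_(i < n.+1) survival n i * mass n i) ^+ 2 +
   q0%:R * (p0 - p0 ^+ 2) +
   (m2 - m1) * (\sum_(i < n.+1) survival n i ^+ 2 * mass n i) +
   m1 * (\sum_(i < n.+1) survival n i * mass n i))%:E.
Proof.
move=> m1E m2E; under eq_fun do rewrite truncated_count_second_moment//.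
apply: cvg_EFin_seq.
set S1 := \sum_(i < n.+1) survival n i * mass n i.
set S2 := \sum_(i < n.+1) survival n i ^+ 2 * mass n i.
have cS1 : \sum_(i < n.+1) survival n i * arrivals1 Q t n K i @[K --> \oo] --> S1.
  by apply: cvg_sum_ord => i; apply: cvgMl_tmp; exact: cvg_arrivals1.
have cM1 := cvg_tail1 m1E; have cM2 := cvg_tail2 m2E.
have cD : \sum_(i < n.+1) \sum_(i' < n.+1) survival n i * survival n i' *
     (arrivals2 Q t n K i i' - (i == i')%:R * arrivals1 Q t n K i) @[K --> \oo] --> S1 ^+ 2.
  have -> : S1 ^+ 2 = \sum_(i < n.+1) \sum_(i' < n.+1) survival n i * survival n i' *
     ((mass n i * mass n i' + (i == i' :> nat)%:R * mass n i) - (i == i')%:R * mass n i).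
    rewrite expr2 /S1 mulr_suml; apply: eq_bigr => i _.
    rewrite mulr_sumr; apply: eq_bigr => i' _.
    by rewrite (val_eqE i i') addrK; ring.
  apply: cvg_sum_ord => i; apply: cvg_sum_ord => i'; apply: cvgMl_tmp.
  apply: cvgB; first exact: cvg_arrivals2.
  by apply: cvgMl_tmp; exact: cvg_arrivals1.
have cB : \sum_(i < n.+1) arrivals1 Q t n K i *
     (tail1 N K * survival n i + (tail2 N K - tail1 N K) * survival n i ^+ 2) @[K --> \oo]
     --> m1 * S1 + (m2 - m1) * S2.
  have -> : m1 * S1 + (m2 - m1) * S2 = \sum_(i < n.+1) mass n i *
     (m1 * survival n i + (m2 - m1) * survival n i ^+ 2).
    rewrite /S1 /S2 !mulr_sumr -big_split /=; apply: eq_bigr => i _; ring.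
  apply: cvg_sum_ord => i; apply: cvgM; first exact: cvg_arrivals1.
  apply: cvgD; first exact: cvgMr_tmp.
  by apply: cvgMr_tmp; exact: cvgB.
have -> : (q0%:R * p0 + m1 * S1) ^+ 2 + q0%:R * (p0 - p0 ^+ 2) + (m2 - m1) * S2 + m1 * S1 =
  q0%:R * p0 + (q0%:R ^+ 2 - q0%:R) * p0 ^+ 2 + 2 * (q0%:R * p0) * (m1 * S1) +
  (m1 ^+ 2 * S1 ^+ 2 + (m1 * S1 + (m2 - m1) * S2)) by ring.
apply: cvgD.
  by apply: cvgD; [exact: cvg_cst|apply: cvgMl_tmp; exact: cvgM].
apply: cvgD => //; apply: cvgM => //.
by rewrite expr2; under eq_fun do rewrite expr2; exact: cvgM.
Qed.

End limits.

(** * Refining the grid *)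

Section truncated_sums.
Context (R : numDomainType).

Lemma sum_stable (f : nat -> R) m K : (forall k, (m <= k)%N -> f k = 0) ->
  (m <= K)%N -> \sum_(k < K) f k = \sum_(k < m) f k.
Proof.
move=> f0 mK; rewrite -(subnKC mK) big_split_ord /= [X in _ + X]big1 ?addr0//.
by move=> k _; rewrite f0// leq_addr.
Qed.

Lemma sum_truncate_le (f : nat -> R) m K : (forall k, 0 <= f k) ->
  (forall k, (m <= k)%N -> f k = 0) -> \sum_(k < K) f k <= \sum_(k < m) f k.
Proof.
move=> f_ge0 f0; have [mK|Km] := leqP m K; first by rewrite (sum_stable f0 mK).
by rewrite -(subnKC (ltnW Km)) big_split_ord /= lerDl sumr_ge0.
Qed.

Variables (m : nat) (b : nat -> nat) (g : nat -> nat -> R).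
Hypothesis g_ge0 : forall k j, 0 <= g k j.
Hypothesis g_out : forall k j, (m <= k)%N || (b k <= j)%N -> g k j = 0.

(** The random ranges of summation in the count are replaced by the constant
    square K x K; these two lemmas compare the two ranges. *)
Lemma sum2_truncate_le K :
  \sum_(k < K) \sum_(j < K) g k j <= \sum_(k < m) \sum_(j < b k) g k j.
Proof.
apply: (@le_trans _ _ (\sum_(k < K) \sum_(j < b k) g k j)).
  apply: ler_sum => k _; apply: (@sum_truncate_le (g k)) => // j bj.
  by rewrite g_out// bj orbT.
apply: (@sum_truncate_le (fun k => \sum_(j < b k) g k j)) => k; first exact: sumr_ge0.
by move=> mk; apply: big1 => j _; rewrite g_out// mk.
Qed.

Lemma sum2_stable K : (m <= K)%N -> (\max_(k < m) b k <= K)%N ->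
  \sum_(k < K) \sum_(j < K) g k j = \sum_(k < m) \sum_(j < b k) g k j.
Proof.
move=> mK bK; rewrite (@sum_stable (fun k => \sum_(j < K) g k j) m)//; last first.
  by move=> k mk; apply: big1 => j _; rewrite g_out// mk.
apply: eq_bigr => k _; apply: (@sum_stable (g k)).
  by move=> j bj; rewrite g_out// bj orbT.
by apply: leq_trans bK; exact: (leq_bigmax (F := fun k : 'I_m => b k)).
Qed.

End truncated_sums.

Lemma near_forall_lt (m : nat) (p : nat -> nat -> Prop) :
  (forall k, (k < m)%N -> \forall n \near \oo, p k n) ->
  \forall n \near \oo, forall k, (k < m)%N -> p k n.
Proof.
elim: m => [|m IH] H; first exact: nearW.
have H1 := IH (fun k km => H k (ltnW km)).
have H2 := H m (ltnSn m).
near=> n => k; rewrite ltnS leq_eqVlt => /predU1P[->|km].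
  by near: n.
by move: k km; near: n.
Unshelve. all: by end_near. Qed.

Section approximation.
Context d (T : measurableType d) (R : realType) (P : probability T R).
Context (lambda : R -> R) (mu : R) (N : {RV P >-> nat}) (q0 : nat).
Context (Q : infinite_server_queue lambda mu N q0) (t : R).
Hypothesis t_ge0 : 0 <= t.

Local Notation M := (arrivals Q).

(** At most one term of this sum is nonzero: the one for the cell that contains
    arrival k. *)
Definition discretised_present n k j w : R :=
  \sum_(i < n.+1) \1_(arrive Q t n i k `&` stays Q (t - grid t n i) k j) w.

Definition discretised_count n w : R :=
  \sum_(j < q0) \1_(initial_stays Q t j) w +
  \sum_(k < M t w) \sum_(j < batch Q k w) discretised_present n k j w.

Lemma arrive_lt n i k w : (i < n.+1)%N -> arrive Q t n i k w -> (k < M t w)%N.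
Proof.
move=> iN /andP[_ kM]; apply: (leq_trans kM).
apply: (poisson_mono (arrivalsP Q)); first exact: grid_ge0.
exact: grid_le.
Qed.

Lemma truncated_countE n K w : truncated_count Q t n K w =
  \sum_(j < q0) \1_(initial_stays Q t j) w +
  \sum_(k < K) \sum_(j < K) (j < batch Q k w)%:R * discretised_present n k j w.
Proof.
rewrite /truncated_count big_sumType /=; congr (_ + _).
rewrite (eq_bigr (fun y : 'I_n.+1 * 'I_K * 'I_K =>
  \1_(present Q t n y.1.1 y.1.2 y.2) w))//.
rewrite -(pair_bigA _ (fun (ik : 'I_n.+1 * 'I_K) (j : 'I_K) =>
  \1_(present Q t n ik.1 ik.2 j) w)) /=.
rewrite -(pair_bigA _ (fun (i : 'I_n.+1) (k : 'I_K) =>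
  \sum_(j < K) \1_(present Q t n i k j) w)) /=.
rewrite exchange_big /=; apply: eq_bigr => k _.
rewrite exchange_big /=; apply: eq_bigr => j _.
rewrite mulr_sumr; apply: eq_bigr => i _.
rewrite /present !indicI /= /has_member (indic_bool R (fun w => (j < batch Q k w)%N)).
by ring.
Qed.

Lemma discretised_present_ge0 n k j w : 0 <= discretised_present n k j w.
Proof. by apply: sumr_ge0 => i _. Qed.

Lemma discretised_present_out n k j w : (M t w <= k)%N ->
  discretised_present n k j w = 0.
Proof.
move=> Mk; apply: big1 => i _; rewrite indicE memNset// => -[ai _].
by have := arrive_lt (ltn_ord i) ai; rewrite ltnNge Mk.
Qed.

Let truncation_out n w k j : (M t w <= k)%N || (batch Q k w <= j)%N ->
  (j < batch Q k w)%:R * discretised_present n k j w = 0.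
Proof.
by move=> /orP[/discretised_present_out ->|]; rewrite ?mulr0// leqNgt => /negPf ->;
  rewrite mul0r.
Qed.

Let drop_member n w : \sum_(k < M t w) \sum_(j < batch Q k w)
    (j < batch Q k w)%:R * discretised_present n k j w =
  \sum_(k < M t w) \sum_(j < batch Q k w) discretised_present n k j w.
Proof.
by apply: eq_bigr => k _; apply: eq_bigr => j _; rewrite ltn_ord mul1r.
Qed.

Lemma truncated_count_le n K w : 0 <= truncated_count Q t n K w <= discretised_count n w.
Proof.
apply/andP; split; first by apply: sumr_ge0 => x _.
rewrite truncated_countE /discretised_count lerD2l -drop_member.
apply: (@sum2_truncate_le _ _ (fun k => batch Q k w)
  (fun k j => (j < batch Q k w)%:R * discretised_present n k j w)).
- by move=> k j; rewrite mulr_ge0// discretised_present_ge0.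
- exact: truncation_out.
Qed.

Lemma truncated_count_stationary n w :
  \forall K \near \oo, truncated_count Q t n K w = discretised_count n w.
Proof.
near=> K; rewrite truncated_countE /discretised_count -drop_member; congr (_ + _).
apply: (@sum2_stable _ _ (fun k => batch Q k w)
  (fun k j => (j < batch Q k w)%:R * discretised_present n k j w)).
- exact: truncation_out.
- by near: K; exact: nbhs_infty_ge.
- by near: K; exact: nbhs_infty_ge.
Unshelve. all: by end_near. Qed.

(** The epoch is an infimum of times where the counting process exceeds k: the
    right end of the cell is such a time, and by monotonicity none of them
    comes before the left end. *)
Lemma arrive_epoch n i k w : arrive Q t n i k w ->
  grid t n i <= epoch M k w <= grid t n i + t / n.+1%:R.
Proof.
move=> /andP[Mk kM].
have lb : lbound [set s | 0 <= s /\ (k < M s w)%N] (grid t n i).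
  move=> s [s0 kMs]; rewrite leNgt; apply/negP => sg.
  have := poisson_mono (arrivalsP Q) w s0 (ltW sg).
  by rewrite leqNgt (leq_ltn_trans Mk kMs).
have mem : [set s | 0 <= s /\ (k < M s w)%N] (grid t n i.+1).
  by split => //; exact: grid_ge0.
apply/andP; split.
  by apply: lb_le_inf => //; exists (grid t n i.+1).
by rewrite -gridS; apply: ge_inf => //; exists (grid t n i).
Qed.

(** The cell ends at the first grid point where the process exceeds k; this is
    not the point 0, where the process vanishes. *)
Lemma arrive_exists n k w : (k < M t w)%N -> exists i : 'I_n.+1, arrive Q t n i k w.
Proof.
move=> kM.
have ex : exists i, (k < M (grid t n i) w)%N by exists n.+1; rewrite grid_last.
have := ex_minnP ex; case: ex_minnP => i ki mini _.
case: i ki mini => [|i] ki mini.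
  by move: ki; rewrite grid0 (poisson_start (arrivalsP Q)).
have iN : (i < n.+1)%N by apply: mini; rewrite grid_last.
exists (Ordinal iN); apply/andP; split => //=.
by rewrite leqNgt; apply/negP => /mini; rewrite ltnn.
Qed.

Lemma discretised_presentE n k j w : (k < M t w)%N ->
  exists2 i : 'I_n.+1, arrive Q t n i k w &
    discretised_present n k j w = (t < grid t n i + service Q k j w)%R%:R.
Proof.
move=> /(arrive_exists n)[i ai]; exists i => //.
rewrite /discretised_present (bigD1 i)//= big1 ?addr0; last first.
  move=> i' ii'; rewrite indicE memNset// => -[ai' _].
  rewrite -val_eqE in ii'.
  by have := arrive_disjoint Q t_ge0 n k ii'; rewrite -subset0; apply;
    split; [exact: ai'|exact: ai].
rewrite -ltrBlDl -(indic_bool R (fun w => (t - grid t n i < service Q k j w)%R)).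
by rewrite indicI /= (indicE R (arrive _ _ _ _ _)) mem_set// mul1r.
Qed.

(** Moving an arrival back in time makes the customer leave earlier. *)
Lemma discretised_present_le n k j w : (k < M t w)%N ->
  discretised_present n k j w <= (t < epoch M k w + service Q k j w)%R%:R.
Proof.
move=> /(discretised_presentE n j)[i /arrive_epoch /andP[ge _] ->].
case: (ltP t (grid t n i + _)) => // lt; rewrite (lt_le_trans lt)//.
by rewrite lerD2r.
Qed.

(** A customer present at time t leaves strictly later, so a shift of its
    arrival by less than the remaining time does not matter; an absent one is
    handled by [discretised_present_le]. *)
Lemma discretised_present_stationary k j w : (k < M t w)%N ->
  \forall n \near \oo,
    discretised_present n k j w = (t < epoch M k w + service Q k j w)%R%:R.
Proof.
move=> kM; have [tE|Et] := ltP t (epoch M k w + service Q k j w); last first.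
  near=> n; apply/eqP; rewrite eq_le discretised_present_ge0 andbT.
  by have := discretised_present_le n j kM; rewrite ltNge Et.
have mesh0 : t * n.+1%:R^-1 @[n --> \oo] --> (t * 0 : R).
  by apply: cvgMl_tmp; exact: cvg_harmonic.
rewrite mulr0 in mesh0.
near=> n; have [i ai ->] := discretised_presentE n j kM.
have /andP[_ le] := arrive_epoch ai.
have small : t / n.+1%:R < epoch M k w + service Q k j w - t.
  near: n; apply: (cvgr_lt _ mesh0); by rewrite subr_gt0.
rewrite (_ : (t < _) = true)//; move: small le.
set e := epoch _ _ _; set s := service _ _ _ _; set h := t / _; set gr := grid _ _ _.
by move=> *; lra.
Unshelve. all: by end_near. Qed.

Lemma number_in_systemE w : (number_in_system Q t w)%:R =
  \sum_(j < q0) \1_(initial_stays Q t j) w +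
  \sum_(k < M t w) \sum_(j < batch Q k w) (t < epoch M k w + service Q k j w)%R%:R :> R.
Proof.
rewrite /number_in_system natrD !natr_sum; congr (_ + _).
  apply: eq_bigr => j _.
  by rewrite /initial_stays (indic_bool R (fun w => (t < initial Q j w)%R)).
by apply: eq_bigr => k _; rewrite natr_sum.
Qed.

Lemma discretised_count_le n w :
  0 <= discretised_count n w <= (number_in_system Q t w)%:R.
Proof.
apply/andP; split.
  apply: addr_ge0; first by apply: sumr_ge0 => j _.
  by apply: sumr_ge0 => k _; apply: sumr_ge0 => j _; exact: discretised_present_ge0.
rewrite number_in_systemE lerD2l; apply: ler_sum => k _; apply: ler_sum => j _.
exact: discretised_present_le.
Qed.

(** On a given path only finitely many customers arrive before t, so the
    thresholds of all of them are eventually passed. *)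
Lemma discretised_count_stationary w :
  \forall n \near \oo, discretised_count n w = (number_in_system Q t w)%:R.
Proof.
have H : \forall n \near \oo, forall k, (k < M t w)%N ->
    forall j, (j < batch Q k w)%N ->
    discretised_present n k j w = (t < epoch M k w + service Q k j w)%R%:R.
  apply: near_forall_lt => k kM; apply: near_forall_lt => j _.
  exact: discretised_present_stationary.
near=> n; rewrite number_in_systemE; congr (_ + _).
apply: eq_bigr => k _; apply: eq_bigr => j _.
have : forall k, (k < M t w)%N -> forall j, (j < batch Q k w)%N ->
    discretised_present n k j w = (t < epoch M k w + service Q k j w)%R%:R.
  by near: n.
by apply.
Unshelve. all: by end_near. Qed.

End approximation.

(** * Moments of the number in system *)

(** The approximation of second moments has the form required by
    [cvg_integral_stationary] too. *)
Lemma sqr_stationary (T : Type) (R : realDomainType) (f_ : nat -> T -> R) (f : T -> R) :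
  (forall n w, 0 <= f_ n w <= f w) -> (forall w, \forall n \near \oo, f_ n w = f w) ->
  (forall n w, 0 <= f_ n w ^+ 2 <= f w ^+ 2) /\
  (forall w, \forall n \near \oo, f_ n w ^+ 2 = f w ^+ 2).
Proof.
move=> f0 ff; split => [n w|w]; last by apply: filterS (ff w) => n ->.
have /andP[h1 h2] := f0 n w; rewrite sqr_ge0/= ler_sqr ?nnegrE//.
exact: le_trans h2.
Qed.

Section queue_moments.
Context d (T : measurableType d) (R : realType) (P : probability T R).
Context (lambda : R -> R) (mu : R) (N : {RV P >-> nat}) (q0 : nat).
Context (Q : infinite_server_queue lambda mu N q0) (t : R).
Hypotheses (mu_gt0 : 0 < mu) (t_ge0 : 0 <= t).
Hypothesis lambda_ge0 : forall s, 0 <= s -> 0 <= lambda s.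
Hypothesis lambda_int :
  (@lebesgue_measure R).-integrable `[0, t] (EFin \o lambda).
Variable m1 : R.
Hypothesis m1E : (\int[P]_w ((N w)%:R)%:E = m1%:E)%E.

Local Notation p0 := (expR (- mu * t)).
Local Notation X := (fun w => (number_in_system Q t w)%:R : R).
Local Notation surviving_load c :=
  (expR (- c * t) *
   \int[@lebesgue_measure R]_(s in `[0%R, t]) (lambda s * expR (c * s)))%R.

Let measurable_truncated n K : measurable_fun setT (truncated_count Q t n K).
Proof.
by apply: measurable_sum => x; apply: measurable_indic; exact: measurable_presence.
Qed.

Let measurable_discretised n : measurable_fun setT (discretised_count Q t n).
Proof.
by have [] := cvg_integral_stationary P (measurable_truncated n)
  (truncated_count_le Q t_ge0 n) (truncated_count_stationary Q t_ge0 n).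
Qed.

Lemma measurable_number_in_system : measurable_fun setT X.
Proof.
by have [] := cvg_integral_stationary P measurable_discretised
  (discretised_count_le Q t_ge0) (discretised_count_stationary Q t_ge0).
Qed.

Let survival_sqr n i : survival mu t n i ^+ 2 = expR (- (2 * mu) * (t - grid t n i)).
Proof. by rewrite /survival expr2 -expRD; congr expR; ring. Qed.

Let cvg_load1 : \sum_(i < n.+1) survival mu t n i * cell_mass lambda t n i
  @[n --> \oo] --> surviving_load mu.
Proof. exact: cvg_riemann_sum (ltW mu_gt0). Qed.

Let cvg_load2 : \sum_(i < n.+1) survival mu t n i ^+ 2 * cell_mass lambda t n i
  @[n --> \oo] --> surviving_load (2 * mu).
Proof.
under eq_fun do under eq_bigr do rewrite survival_sqr.
by apply: cvg_riemann_sum => //; rewrite mulr_ge0// ltW.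
Qed.

Lemma number_in_system_mean :
  (\int[P]_w (X w)%:E = (q0%:R * p0 + m1 * surviving_load mu)%:E)%E.
Proof.
have [_ cX] := cvg_integral_stationary P measurable_discretised
  (discretised_count_le Q t_ge0) (discretised_count_stationary Q t_ge0).
have meanE n : (\int[P]_w (discretised_count Q t n w)%:E =
    (q0%:R * p0 + m1 * \sum_(i < n.+1) survival mu t n i * cell_mass lambda t n i)%:E)%E.
  have [_ cD] := cvg_integral_stationary P (measurable_truncated n)
    (truncated_count_le Q t_ge0 n) (truncated_count_stationary Q t_ge0 n).
  apply: (cvg_unique _ cD) => //.
  exact: cvg_truncated_count_mean.
apply: (cvg_unique _ cX) => //; rewrite /=; under eq_fun do rewrite meanE.
apply: cvg_EFin_seq; apply: cvgD; first exact: cvg_cst.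
exact: cvgMl_tmp.
Qed.

(** Displayed as the square of the mean plus the variance. *)
Lemma number_in_system_second_moment m2 :
  (\int[P]_w ((N w)%:R ^+ 2)%:E = m2%:E)%E ->
  (\int[P]_w (X w ^+ 2)%:E = ((q0%:R * p0 + m1 * surviving_load mu) ^+ 2 +
   q0%:R * (p0 - p0 ^+ 2) + (m2 - m1) * surviving_load (2 * mu) +
   m1 * surviving_load mu)%:E)%E.
Proof.
move=> m2E.
have [le2 st2] := sqr_stationary (discretised_count_le Q t_ge0)
  (discretised_count_stationary Q t_ge0).
have [_ cX] := cvg_integral_stationary P
  (fun n => measurable_funX 2 (measurable_discretised n)) le2 st2.
have momentE n : (\int[P]_w (discretised_count Q t n w ^+ 2)%:E =
    ((q0%:R * p0 + m1 * \sum_(i < n.+1) survival mu t n i * cell_mass lambda t n i) ^+ 2 +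
   q0%:R * (p0 - p0 ^+ 2) +
   (m2 - m1) * (\sum_(i < n.+1) survival mu t n i ^+ 2 * cell_mass lambda t n i) +
   m1 * (\sum_(i < n.+1) survival mu t n i * cell_mass lambda t n i))%:E)%E.
  have [le2n st2n] := sqr_stationary (truncated_count_le Q t_ge0 n)
    (truncated_count_stationary Q t_ge0 n).
  have [_ cD] := cvg_integral_stationary P
    (fun K => measurable_funX 2 (measurable_truncated n K)) le2n st2n.
  apply: (cvg_unique _ cD) => //.
  exact: cvg_truncated_count_second_moment.
apply: (cvg_unique _ cX) => //; rewrite /=; under eq_fun do rewrite momentE.
apply: cvg_EFin_seq.
have cM : q0%:R * p0 + m1 * \sum_(i < n.+1) survival mu t n i * cell_mass lambda t n i
  @[n --> \oo] --> q0%:R * p0 + m1 * surviving_load mu.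
  by apply: cvgD; [exact: cvg_cst|exact: cvgMl_tmp].
apply: cvgD; last exact: cvgMl_tmp.
apply: cvgD; last exact: cvgMl_tmp.
apply: cvgD; last exact: cvg_cst.
by rewrite expr2; under eq_fun do rewrite expr2; exact: cvgM.
Qed.

End queue_moments.

Local Open Scope ereal_scope.

Theorem proposition3p1 (R : realType) (d : measure_display)
    (T : measurableType d) (P : probability T R)
    (lambda : R -> R) (mu : R) (N : {RV P >-> nat}) (q0 : nat)
    (Q : infinite_server_queue lambda mu N q0)
    (lambda_gt0 : forall t : R, (0 <= t)%R -> (0 < lambda t)%R)
    (lambda_loc : forall t : R, (0 <= t)%R ->
      (@lebesgue_measure R).-integrable `[0%R, t] (EFin \o lambda))
    (mu_gt0 : (0 < mu)%R)
    (N_mean : 'E_P[(fun w => (N w)%:R)%R] < +oo) :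
  (forall t : R, (0 <= t)%R ->
     'E_P[(fun w => (number_in_system Q t w)%:R)%R] =
       (q0%:R * expR (- mu * t))%:E
       + (expR (- mu * t))%:E * 'E_P[(fun w => (N w)%:R)%R]
         * \int[lebesgue_measure]_(s in `[0%R, t])
             (lambda s * expR (mu * s))%:E)
  /\
  ('E_P[(fun w => (N w)%:R ^+ 2)%R] < +oo ->
   forall t : R, (0 <= t)%R ->
     'V_P[(fun w => (number_in_system Q t w)%:R)%R] =
       (q0%:R * (expR (- mu * t) - expR (- 2 * mu * t)))%:E
       + (expR (- 2 * mu * t))%:E
         * ('E_P[(fun w => (N w)%:R ^+ 2)%R] - 'E_P[(fun w => (N w)%:R)%R])
         * \int[lebesgue_measure]_(s in `[0%R, t])
             (lambda s * expR (2 * mu * s))%:E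
       + (expR (- mu * t))%:E * 'E_P[(fun w => (N w)%:R)%R]
         * \int[lebesgue_measure]_(s in `[0%R, t])
             (lambda s * expR (mu * s))%:E).
Proof.
have lambda_ge0 s : (0 <= s)%R -> (0 <= lambda s)%R by move=> /lambda_gt0/ltW.
have integralE c t : (0 <= c)%R -> (0 <= t)%R ->
    \int[lebesgue_measure]_(s in `[0%R, t]) (lambda s * expR (c * s))%:E =
    (\int[lebesgue_measure]_(s in `[0%R, t]) (lambda s * expR (c * s)))%R%:E.
  move=> c0 t0; rewrite /Rintegral fineK//.
  apply: integrable_fin_num; first exact: measurable_itv.
  exact: (integrable_lambda_expR (lambda_loc t t0) c0).
have [m1 m1E] : exists m1, 'E_P[(fun w => (N w)%:R)%R] = m1%:E.
  exists (fine 'E_P[(fun w => (N w)%:R)%R]); rewrite fineK// ge0_fin_numE//.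
  exact: expectation_ge0.
have meanE t (t0 : (0 <= t)%R) :
    'E_P[(fun w => (number_in_system Q t w)%:R)%R] =
    (q0%:R * expR (- mu * t) + m1 * (expR (- mu * t) *
      (\int[lebesgue_measure]_(s in `[0%R, t]) (lambda s * expR (mu * s)))))%R%:E.
  rewrite unlock; apply: number_in_system_mean => //; first exact: lambda_loc.
  by rewrite -m1E unlock.
split => [t t0|N2_mean t t0].
  rewrite meanE// m1E integralE// ?ltW// -!EFinM -EFinD; congr EFin; ring.
have [m2 m2E] : exists m2, 'E_P[(fun w => (N w)%:R ^+ 2)%R] = m2%:E.
  exists (fine 'E_P[(fun w => (N w)%:R ^+ 2)%R]); rewrite fineK// ge0_fin_numE//.
  by apply: expectation_ge0 => w; exact: sqr_ge0.
have mX := measurable_number_in_system Q t0.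
have secondE := @number_in_system_second_moment _ _ _ _ _ _ _ _ Q t mu_gt0 t0
  lambda_ge0 (lambda_loc t t0) m1.
(* The expectations are needed as integrals to match the moment lemmas. *)
move: (m1E) (m2E); rewrite unlock => m1I m2I.
have {}secondE := secondE m1I m2 m2I.
have X1 : (fun w => (number_in_system Q t w)%:R)%R \in Lfun P 1.
  apply/Lfun1_integrable/integrableP; split; first exact/measurable_EFinP.
  under eq_integral do rewrite /= ger0_norm//.
  by have := meanE t t0; rewrite unlock => ->; rewrite ltry.
have X2 : ((fun w => (number_in_system Q t w)%:R) *
    (fun w => (number_in_system Q t w)%:R))%R \in Lfun P 1.
  apply/Lfun1_integrable/integrableP; split.
    by apply/measurable_EFinP; exact: measurable_funM.
  under eq_integral do rewrite /= ger0_norm ?mulr_ge0// -expr2.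
  by rewrite secondE ltry.
rewrite /variance covarianceE//.
have -> : 'E_P[((fun w => (number_in_system Q t w)%:R) *
    (fun w => (number_in_system Q t w)%:R))%R] =
    \int[P]_w ((number_in_system Q t w)%:R ^+ 2)%:E.
  by rewrite unlock; apply: eq_integral => w _; rewrite expr2.
rewrite secondE meanE// m1I m2I !integralE// ?mulr_ge0 ?ltW//.
rewrite -!(EFinB, EFinM, EFinD); congr EFin.
have -> : (- 2 * mu * t = - mu * t + - mu * t)%R by ring.
have -> : (- (2 * mu) * t = - mu * t + - mu * t)%R by ring.
rewrite expRD; ring.
Qed.
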